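(* Consider a robust Markov decision process with $S$ states, $A$ actions and the $s$-rectangular Kullback-Leibler divergence ambiguity set ($\phi(t)=t\log t-t+1$) with budget $\kappa>0$ described in the context, with robust Bellman operator $\mathfrak{J}$. For every $\bm{v}\in\mathbb{R}^S$ with $\bm{v}\le\bm{v}^\star$ and $\bm{r}_{sa}+\lambda\bm{v}\ge\bm{0}$ for all $s\in\mathcal{S}$, $a\in\mathcal{A}$, the robust Bellman iteration $\mathfrak{J}(\bm{v})$ (across all states) can be computed to any accuracy $\epsilon>0$ in time $$\mathcal{O}\left(S^2\cdot A\log A\cdot\log\left[\frac{\overline{R}^2\cdot\log(\min\{\overline{\bm{p}}\}^{-1})}{\epsilon^2\kappa}\right]\cdot\log\frac{\overline{R}}{\epsilon}\right).$$
   Context: Notation: $\Delta_n=\{\bm{p}\in\mathbb{R}^n_+ : \mathbf{e}^\top\bm{p}=1\}$ with $\mathbf{e}$ the all-ones vector. Inequalities between vectors are component-wise. Robust MDP: finite state space $\mathcal{S}=\{1,\dots,S\}$, finite action space $\mathcal{A}=\{1,\dots,A\}$, discount factor $\lambda\in(0,1)$, rewards $r_{sas'}\in\mathbb{R}_+$ with $\bm{r}_{sa}=(r_{sas'})_{s'\in\mathcal{S}}$, nominal transition probabilities $\overline{\bm{p}}_{sa}\in\Delta_S$ with $\overline{\bm{p}}_{sa}>\bm{0}$; $\min\{\overline{\bm{p}}\}$ is the smallest nominal transition probability $\overline{p}_{sas'}$ over all $s,a,s'$. With $\phi(t)=t\log t-t+1$ ($0\log 0=0$), let $d_a(\bm{p}_{sa},\overline{\bm{p}}_{sa})=\sum_{s'\in\mathcal{S}}\overline{p}_{sas'}\,\phi(p_{sas'}/\overline{p}_{sas'})$.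 For a budget $\kappa>0$, the ambiguity set of state $s$ is $\mathcal{P}_s=\{\bm{p}_s=(\bm{p}_{sa})_{a\in\mathcal{A}}\in(\Delta_S)^A : \sum_{a\in\mathcal{A}}d_a(\bm{p}_{sa},\overline{\bm{p}}_{sa})\le\kappa\}$. The robust Bellman operator $\mathfrak{J}:\mathbb{R}^S\to\mathbb{R}^S$ is $$[\mathfrak{J}(\bm{v})]_s=\max_{\bm{\pi}_s\in\Delta_A}\ \min_{\bm{p}_s\in\mathcal{P}_s}\ \sum_{a\in\mathcal{A}}\pi_{sa}\cdot\bm{p}_{sa}^\top(\bm{r}_{sa}+\lambda\bm{v}),\qquad s\in\mathcal{S},$$ and $\bm{v}^\star$ denotes the limit of the iteration $\bm{v}^{t+1}=\mathfrak{J}(\bm{v}^t)$ (the fixed point of $\mathfrak{J}$). Further, $\overline{R}=(1-\lambda)^{-1}\max\{r_{sas'} : s,s'\in\mathcal{S},\ a\in\mathcal{A}\}$. $\mathfrak{J}(\bm{v})$ is computed to accuracy $\epsilon$ by any $\bm{v}'\in\mathbb{R}^S$ with $\|\bm{v}'-\mathfrak{J}(\bm{v})\|_\infty\le\epsilon$. Running time counts elementary operations on real numbers (arithmetic, comparisons, evaluations of elementary functions such as $\exp$ and $\log$), each at unit cost. *)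

(* Defs.v *)
(* MathComp / MathComp-Analysis *)
From mathcomp Require Import all_boot all_order all_algebra.
From mathcomp Require Import all_classical all_reals all_analysis.

Set Implicit Arguments.
Unset Strict Implicit.
Unset Printing Implicit Defensive.

Import Order.TTheory GRing.Theory Num.Theory.
Import numFieldNormedType.Exports.
Local Open Scope classical_set_scope.
Local Open Scope ring_scope.

(** * Robust Markov decision processes *)

Definition simplex (R : realType) (n : nat) : set 'rV[R]_n :=
  [set p | (forall i, 0 <= p 0 i) /\ \sum_i p 0 i = 1].

(* The convention 0 log 0 = 0 holds because [ln 0 = 0] in the library. *)
Definition phi (R : realType) (t : R) : R := t * ln t - t + 1.

Definition divergence (R : realType) (n : nat) (p q : 'rV[R]_n) : R :=
  \sum_i q 0 i * phi (p 0 i / q 0 i).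

(* [reward s a s'] and [nominal s a s'] stand for r_{sas'} and
   pbar_{sas'}: for every state s, a matrix whose row a belongs to action a. *)
Record rmdp (R : realType) (S A : nat) := RMDP {
  discount : R;
  reward : 'I_S -> 'M[R]_(A, S);
  nominal : 'I_S -> 'M[R]_(A, S);
  budget : R;
  discount_gt0 : 0 < discount;
  discount_lt1 : discount < 1;
  reward_ge0 : forall s a s', 0 <= reward s a s';
  nominal_simplex : forall s a, simplex (row a (nominal s));
  nominal_gt0 : forall s a s', 0 < nominal s a s';
  budget_gt0 : 0 < budget }.

Section Rmdp.
Variables (R : realType) (S A : nat) (M : rmdp R S A).

Definition ambiguity (s : 'I_S) : set 'M[R]_(A, S) :=
  [set p | (forall a, simplex (row a p)) /\
           \sum_a divergence (row a p) (row a (nominal M s)) <= budget M].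

Definition expected_value (v : 'rV[R]_S) (s : 'I_S)
    (pi : 'rV[R]_A) (p : 'M[R]_(A, S)) : R :=
  \sum_a pi 0 a * \sum_s' p a s' * (reward M s a s' + discount M * v 0 s').

(* The maximum and the minimum are attained (continuous function, nonempty
   compact sets), hence equal to [sup] and [inf]. *)
Definition bellman (v : 'rV[R]_S) : 'rV[R]_S :=
  \row_s sup [set inf [set expected_value v s pi p | p in ambiguity s]
             | pi in @simplex R A].

(* [bellman] is a contraction: there is exactly one such [u]. *)
Definition is_value_limit (u : 'rV[R]_S) : Prop :=
  forall v0 : 'rV[R]_S, iter t bellman v0 @[t --> \oo] --> u.

(* Rewards are nonnegative, so the neutral element 0 does not alter the max. *)
Definition Rbar : R :=
  (1 - discount M)^-1 *
  \big[Num.max/0]_s \big[Num.max/0]_a \big[Num.max/0]_s' reward M s a s'.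

(* Probabilities are at most 1, so the neutral element 1 does not alter the
   min. *)
Definition min_nominal : R :=
  \big[Num.min/1]_s \big[Num.min/1]_a \big[Num.min/1]_s' nominal M s a s'.

End Rmdp.

(** * A real random-access machine

    Structured programs over integer registers (used for addressing), real
    registers and real arrays with computed indices.  Programs are finite
    syntactic objects whose only constants are natural numbers; in particular
    they do not depend on the instance nor contain arbitrary real constants. *)

Inductive iexp :=
| IVar of nat
| ICst of nat
| IAdd of iexp & iexp
| ISub of iexp & iexp
| IMul of iexp & iexp.

Inductive rexp :=
| RVar of nat
| RCst of nat
| RLoad of nat & iexp
| RAdd of rexp & rexp
| RSub of rexp & rexp
| RMul of rexp & rexp
| RDiv of rexp & rexp
| RExp of rexp
| RLog of rexp.

Inductive bexp :=
| BILe of iexp & iexp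
| BRLe of rexp & rexp
| BNot of bexp
| BAnd of bexp & bexp.

Inductive cmd :=
| Skip
| SetI of nat & iexp
| SetR of nat & rexp
| Store of nat & iexp & rexp
| Seq of cmd & cmd
| If of bexp & cmd & cmd
| While of bexp & cmd.

Record memory (R : realType) := Memory {
  ireg : nat -> nat;
  rreg : nat -> R;
  arr : nat -> nat -> R }.

Section Machine.
Variable R : realType.
Implicit Types (st : memory R) (e : iexp) (x : rexp) (b : bexp) (c : cmd).

(* Integer subtraction is truncated at 0. *)
Fixpoint ieval st e : nat :=
  match e with
  | IVar i => ireg st i
  | ICst n => n
  | IAdd e1 e2 => (ieval st e1 + ieval st e2)%N
  | ISub e1 e2 => (ieval st e1 - ieval st e2)%N
  | IMul e1 e2 => (ieval st e1 * ieval st e2)%N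
  end.

(* Operations are total, with the library's values x / 0 = 0 and ln x = 0 for
   x <= 0; a program could obtain the same values by testing its operands. *)
Fixpoint reval st x : R :=
  match x with
  | RVar i => rreg st i
  | RCst n => n%:R
  | RLoad k e => arr st k (ieval st e)
  | RAdd x1 x2 => reval st x1 + reval st x2
  | RSub x1 x2 => reval st x1 - reval st x2
  | RMul x1 x2 => reval st x1 * reval st x2
  | RDiv x1 x2 => reval st x1 / reval st x2
  | RExp x1 => expR (reval st x1)
  | RLog x1 => ln (reval st x1)
  end.

Fixpoint beval st b : bool :=
  match b with
  | BILe e1 e2 => (ieval st e1 <= ieval st e2)%N
  | BRLe x1 x2 => reval st x1 <= reval st x2
  | BNot b1 => ~~ beval st b1
  | BAnd b1 b2 => beval st b1 && beval st b2
  end.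

Definition set_ireg st (i n : nat) : memory R :=
  Memory [eta ireg st with i |-> n] (rreg st) (arr st).

Definition set_rreg st (i : nat) (y : R) : memory R :=
  Memory (ireg st) [eta rreg st with i |-> y] (arr st).

Definition set_arr st (k i : nat) (y : R) : memory R :=
  Memory (ireg st) (rreg st)
    (fun k' i' => if (k' == k) && (i' == i) then y else arr st k' i').

End Machine.

(* Every operation, constant, register access and memory access has unit
   cost: the cost of an expression is its number of nodes. *)
Fixpoint icost (e : iexp) : nat :=
  match e with
  | IVar _ | ICst _ => 1
  | IAdd e1 e2 | ISub e1 e2 | IMul e1 e2 => (icost e1 + icost e2).+1
  end.

Fixpoint rcost (x : rexp) : nat :=
  match x with
  | RVar _ | RCst _ => 1
  | RLoad _ e => (icost e).+1
  | RAdd x1 x2 | RSub x1 x2 | RMul x1 x2 | RDiv x1 x2 =>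
      (rcost x1 + rcost x2).+1
  | RExp x1 | RLog x1 => (rcost x1).+1
  end.

Fixpoint bcost (b : bexp) : nat :=
  match b with
  | BILe e1 e2 => (icost e1 + icost e2).+1
  | BRLe x1 x2 => (rcost x1 + rcost x2).+1
  | BNot b1 => (bcost b1).+1
  | BAnd b1 b2 => (bcost b1 + bcost b2).+1
  end.

(* [exec c st t st']: from memory [st], the program [c] halts in memory [st']
   after running for time [t]. *)
Inductive exec (R : realType) : cmd -> memory R -> nat -> memory R -> Prop :=
| ExecSkip st : exec Skip st 1 st
| ExecSetI st i e :
    exec (SetI i e) st (icost e).+1 (set_ireg st i (ieval st e))
| ExecSetR st i x :
    exec (SetR i x) st (rcost x).+1 (set_rreg st i (reval st x))
| ExecStore st k e x :
    exec (Store k e x) st (icost e + rcost x).+1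
      (set_arr st k (ieval st e) (reval st x))
| ExecSeq st1 st2 st3 t1 t2 c1 c2 :
    exec c1 st1 t1 st2 -> exec c2 st2 t2 st3 ->
    exec (Seq c1 c2) st1 (t1 + t2) st3
| ExecIfT st st' t b c1 c2 : beval st b -> exec c1 st t st' ->
    exec (If b c1 c2) st (bcost b + t).+1 st'
| ExecIfF st st' t b c1 c2 : ~~ beval st b -> exec c2 st t st' ->
    exec (If b c1 c2) st (bcost b + t).+1 st'
| ExecWhileT st1 st2 st3 t1 t2 b c : beval st1 b ->
    exec c st1 t1 st2 -> exec (While b c) st2 t2 st3 ->
    exec (While b c) st1 (bcost b + t1 + t2).+1 st3
| ExecWhileF st b c : ~~ beval st b ->
    exec (While b c) st (bcost b).+1 st.

(** * Input and output of the robust Bellman iteration *)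

(* Integer registers 0, 1 hold S, A; real registers 0, 1, 2 hold the discount
   factor, the budget and the accuracy; arrays 0, 1, 2 hold the nominal
   probabilities, the rewards (both flattened in lexicographic order) and v.
   The rest of the memory is arbitrary. *)
Record encodes (R : realType) (S A : nat) (M : rmdp R S A) (v : 'rV[R]_S)
    (eps : R) (st : memory R) : Prop := Encodes {
  encodes_S : ireg st 0 = S;
  encodes_A : ireg st 1 = A;
  encodes_discount : rreg st 0 = discount M;
  encodes_budget : rreg st 1 = budget M;
  encodes_eps : rreg st 2 = eps;
  encodes_nominal : forall (s : 'I_S) (a : 'I_A) (s' : 'I_S),
    arr st 0 ((s * A + a) * S + s')%N = nominal M s a s';
  encodes_reward : forall (s : 'I_S) (a : 'I_A) (s' : 'I_S),
    arr st 1 ((s * A + a) * S + s')%N = reward M s a s';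
  encodes_value : forall s : 'I_S, arr st 2 s = v 0 s }.

(* The output is read from array 3. *)
Definition output (R : realType) (S : nat) (st : memory R) : 'rV[R]_S :=
  \row_s arr st 3 s.

(* Logarithm in an O-bound: a factor log x that is below 1 (or negative, as may
   happen for log A with A = 1 or for log (Rbar / eps) with eps > Rbar) counts
   as the constant 1. *)
Definition Olog (R : realType) (x : R) : R := Num.max 1 (ln x).

Definition bellman_time (R : realType) (S A : nat) (M : rmdp R S A) (eps : R) : R :=
  S%:R ^+ 2 * (A%:R * Olog (A%:R : R))
  * Olog (Rbar M ^+ 2 * ln (min_nominal M)^-1 / (eps ^+ 2 * budget M))
  * Olog (Rbar M / eps).

(* Main.v *)
(* Write b = r + lambda v.  By minimax, the value of a state is the least th
   such that some p in the ambiguity set has p_a . b_a <= th for all actions a,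
   that is sum_a D_a(th) <= kappa with
     D_a(th) = max_{al >= 0} G_a(al),
     G_a(al) = - log sum_j pbar_aj exp (- al (b_aj - th)).
   Both directions of this duality follow from the Gibbs variational principle
     KL(p, pbar) >= G(al) - al (p . (b - th)),
   with equality at the tilted distribution p ~ pbar exp (- al (b - th)).
   The program bisects on th in [0, Rbar], and for each th and a on the
   multiplier al in [0, max], deciding by the sign of the derivative of G_a.
   With max = log(1/min pbar) / (eps/2) + tol the interval is long enough as
   soon as th is eps/2 above min_j b_aj, and an error
   tol = kappa eps / (4 A Rbar^2) in al changes sum_a D_a by at most
   kappa (eps/2) / (2 Rbar), which is worth at most eps/2 in th because
   sum_a al_a is of order at least kappa / Rbar at the critical th.  Since
   max / tol = 8 A X + 1 with X the argument of the first logarithm of the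
   bound, the inner bisection takes O(log A log X) steps. *)
Require Import Defs.
From mathcomp Require Import all_boot all_order all_algebra.
From mathcomp Require Import all_classical all_reals all_analysis.
From mathcomp Require Import ring lra zify.

Set Implicit Arguments.
Unset Strict Implicit.
Unset Printing Implicit Defensive.

Import Order.TTheory GRing.Theory Num.Theory.
Import numFieldNormedType.Exports.
Local Open Scope classical_set_scope.
Local Open Scope ring_scope.

(** * The Gibbs variational principle *)

Lemma phi_expR (R : realType) (u : R) : phi (expR u) = expR u * u - expR u + 1.
Proof. by rewrite /phi expRK. Qed.

(** Fenchel's inequality: the conjugate of [phi] at [u] is [expR u - 1]. For [t > 0] it is
    [1 + x <= expR x] at [x = u - ln t], multiplied by [t]; [phi_expR] records that it is tight at
    [t = expR u]. *)
Lemma phi_fenchel (R : realType) (t u : R) :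
  0 <= t -> t * u - expR u + 1 <= phi t.
Proof.
rewrite le_eqVlt => /predU1P[<-|t0].
  by rewrite /phi !mul0r; have := expR_gt0 u; lra.
have := expR_ge1Dx (u - ln t).
rewrite expRD expRN lnK ?posrE// ler_pdivlMr// /phi; lra.
Qed.

Section Gibbs.
Variables (R : realType) (n : nat) (q : 'rV[R]_n).
Hypotheses (q_simplex : simplex q) (q_gt0 : forall j, 0 < q 0 j).
Implicit Types (c : 'I_n -> R) (al : R) (p : 'rV[R]_n).

Definition partition_function c al := \sum_j q 0 j * expR (- (al * c j)).

(** Minus the derivative of [partition_function] in [al]. Divided by [partition_function] it is both
    the derivative of [free_energy] and the mean of [c] under [gibbs]. *)
Definition tilted_sum c al := \sum_j c j * (q 0 j * expR (- (al * c j))).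

Definition free_energy c al := - ln (partition_function c al).

Definition gibbs c al : 'rV[R]_n :=
  \row_j (q 0 j * expR (- (al * c j)) / partition_function c al).

Lemma simplex_size : (0 < n)%N.
Proof.
case: n q q_simplex => // q0 [_].
by rewrite big_ord0 => /esym/eqP; rewrite oner_eq0.
Qed.

Lemma partition_function_gt0 c al : 0 < partition_function c al.
Proof.
have F j : 0 < q 0 j * expR (- (al * c j)) by rewrite mulr_gt0// expR_gt0.
rewrite /partition_function (bigD1 (Ordinal simplex_size))//=.
by rewrite ltr_wpDr// sumr_ge0// => j _; exact: ltW.
Qed.

Lemma partition_function0 c : partition_function c 0 = 1.
Proof.
rewrite -q_simplex.2; apply: eq_bigr => j _.
by rewrite mul0r oppr0 expR0 mulr1.
Qed.

Lemma gibbs_simplex c al : simplex (gibbs c al).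
Proof.
have Z0 := partition_function_gt0 c al.
split=> [j|].
  by rewrite mxE divr_ge0 ?mulr_ge0 ?expR_ge0 ?ltW.
under eq_bigr do rewrite mxE.
by rewrite -mulr_suml divff ?gt_eqF.
Qed.

Lemma gibbs_mean c al :
  \sum_j gibbs c al 0 j * c j = tilted_sum c al / partition_function c al.
Proof. by rewrite mulr_suml; apply: eq_bigr => j _; rewrite mxE; ring. Qed.

Lemma sum_exponent (w : 'rV[R]_n) c (al k : R) : simplex w ->
  \sum_j w 0 j * (- (al * c j) - k) = - (al * \sum_j w 0 j * c j) - k.
Proof.
move=> [_ w1]; under eq_bigr do rewrite mulrBr.
rewrite sumrB -mulr_suml w1 mul1r mulr_sumr -sumrN.
by congr (_ - _); apply: eq_bigr => j _; ring.
Qed.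

(** The exponent is the log-likelihood ratio of [gibbs] to [q]. It is the Fenchel dual variable in
    [gibbs_variational] and makes that inequality tight in [divergence_gibbs]. *)
Lemma gibbs_ratio c al j :
  q 0 j * expR (- (al * c j) - ln (partition_function c al)) = gibbs c al 0 j.
Proof.
rewrite mxE expRD [expR (- ln _)]expRN lnK ?posrE ?partition_function_gt0//.
exact: mulrA.
Qed.

(** Fenchel's inequality applied coordinatewise at the log-likelihood ratio of the tilted
    distribution. The terms without [p] cancel because [gibbs] and [q] both have mass one. *)
Lemma gibbs_variational c al p : simplex p ->
  free_energy c al - al * \sum_j p 0 j * c j <= divergence p q.
Proof.
move=> sp.
pose u j := - (al * c j) - ln (partition_function c al).
have -> : free_energy c al - al * \sum_j p 0 j * c j =
    \sum_j (p 0 j * u j - q 0 j * expR (u j) + q 0 j).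
  rewrite big_split/= sumrB sum_exponent// q_simplex.2.
  under [X in _ - X + 1]eq_bigr do rewrite gibbs_ratio.
  by rewrite (gibbs_simplex c al).2 /free_energy; ring.
apply: ler_sum => j _.
have /(phi_fenchel (u j)) : 0 <= p 0 j / q 0 j.
  by rewrite divr_ge0 ?sp.1 ?ltW.
move=> /(ler_wpM2l (ltW (q_gt0 j))); apply: le_trans.
rewrite le_eqVlt; apply/orP; left; apply/eqP; move: (u j) (expR _) => uj e.
by field; rewrite gt_eqF.
Qed.

Lemma divergence_gibbs c al : divergence (gibbs c al) q =
  free_energy c al - al * \sum_j gibbs c al 0 j * c j.
Proof.
pose u j := - (al * c j) - ln (partition_function c al).
have sp := gibbs_simplex c al.
transitivity (\sum_j (gibbs c al 0 j * u j - gibbs c al 0 j + q 0 j)).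
  apply: eq_bigr => j _; rewrite -gibbs_ratio -/(u j) mulrAC divff ?gt_eqF//.
  by rewrite mul1r phi_expR; ring.
by rewrite big_split/= sumrB sum_exponent// q_simplex.2 sp.2 /free_energy; ring.
Qed.

Lemma divergence_ge0 p : simplex p -> 0 <= divergence p q.
Proof.
move=> /(gibbs_variational (fun=> 0) 0); apply: le_trans.
by rewrite mul0r subr0 /free_energy partition_function0 ln1 oppr0.
Qed.

Lemma divergence_refl : divergence q q = 0.
Proof.
rewrite /divergence big1// => j _.
by rewrite divff ?gt_eqF// /phi ln1 mulr0 sub0r addNr mulr0.
Qed.

(** The variational inequality tested at [q] itself, where the divergence vanishes. *)
Lemma free_energy_le c al : free_energy c al <= al * \sum_j q 0 j * c j.
Proof.
by have := gibbs_variational c al q_simplex; rewrite divergence_refl subr_le0.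
Qed.

(** * Locating the optimal multiplier *)

Lemma tilted_sum_continuous c : continuous (tilted_sum c).
Proof.
apply: continuous_big => [|j _ x]; first exact: add_continuous.
apply: cvgM; [exact: cvg_cst | apply: cvgM; [exact: cvg_cst |]].
apply: continuous_cvg; first exact: continuous_expR.
by apply: cvgN; apply: cvgM; [exact: cvg_id | exact: cvg_cst].
Qed.

(** These are the optimality conditions, with complementary slackness, for maximising [free_energy]
    over nonnegative multipliers. Either the derivative is already nonpositive at [lo], which then
    must be 0, or the intermediate value theorem gives a zero. *)
Lemma tilted_sum_root c lo hi : 0 <= lo -> lo <= hi -> tilted_sum c hi <= 0 ->
  (lo = 0 \/ 0 < tilted_sum c lo) ->
  exists2 al, lo <= al <= hi & tilted_sum c al <= 0 /\ al * tilted_sum c al = 0.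
Proof.
move=> lo0 lohi Nhi Nlo.
have [Nlo'|Nlo'] := leP (tilted_sum c lo) 0.
  exists lo; rewrite ?lexx//; split=> //.
  by case: Nlo => [->|]; [rewrite mul0r | rewrite ltNge Nlo'].
have [||x] := @IVT _ (tilted_sum c) lo hi 0 lohi.
- apply: continuous_subspaceT; exact: tilted_sum_continuous.
- by rewrite ge_min Nhi orbT le_max ltW.
by rewrite in_itv /= => xI x0; exists x => //; rewrite x0 mulr0.
Qed.

(** The witness is the tilted distribution at the exact optimum [al] in the bracket: complementary
    slackness makes its divergence equal to [free_energy c al]. It remains to compare this with the
    value at the computed endpoint [hi]. *)
Lemma primal_near_dual c (B lo hi tol : R) : 0 <= B ->
  (forall j, - B <= c j) ->
  0 <= lo -> lo <= hi -> hi - lo <= tol -> tilted_sum c hi <= 0 ->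
  (lo = 0 \/ 0 < tilted_sum c lo) ->
  exists2 p, simplex p & \sum_j p 0 j * c j <= 0 /\
    divergence p q <= free_energy c hi + tol * B.
Proof.
move=> B0 cB lo0 lohi tolP Nhi Nlo.
have [al /andP[al1 al2] [Nal alN]] := tilted_sum_root lo0 lohi Nhi Nlo.
have Z0 := partition_function_gt0 c al.
exists (gibbs c al); first exact: gibbs_simplex.
rewrite divergence_gibbs gibbs_mean mulrA alN mul0r subr0; split.
  by rewrite pmulr_lle0 ?invr_gt0.
(* Testing the inequality at [gibbs c hi] yields the tangent bound of the concave [free_energy] at
   [hi], whose slope is the mean [m] below. *)
have := gibbs_variational c al (gibbs_simplex c hi).
rewrite divergence_gibbs.
have : - B <= \sum_j gibbs c hi 0 j * c j.
  have [g0 g1] := gibbs_simplex c hi.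
  rewrite -[leLHS]mul1r -g1 mulr_suml; apply: ler_sum => j _.
  exact: ler_wpM2l.
set m := \sum_j _ => mB.
have : (hi - al) * B <= tol * B by rewrite ler_wpM2r//; lra.
have : 0 <= (hi - al) * (m + B) by rewrite mulr_ge0; lra.
lra.
Qed.

(** The single term [j] already makes the partition function at least 1, so [free_energy] is at most
    0. Since the divergence of the tilted distribution is nonnegative, [al] times its mean cost is
    at most [free_energy], so this mean is nonpositive. *)
Lemma tilted_sum_large c (e al : R) j : 0 < al ->
  - ln (q 0 j) <= al * e -> c j <= - e -> tilted_sum c al <= 0.
Proof.
move=> al0 qe ce.
have Z0 := partition_function_gt0 c al.
have := divergence_ge0 (gibbs_simplex c al).
rewrite divergence_gibbs gibbs_mean subr_ge0.
have : free_energy c al <= 0.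
  have : - ln (q 0 j) + al * c j <= 0.
    have : al * c j <= al * - e by rewrite ler_pM2l.
    lra.
  apply: le_trans; rewrite /free_energy lerNl opprD opprK -[X in _ + X]expRK.
  rewrite -lnM ?posrE ?expR_gt0// ler_ln ?posrE ?mulr_gt0 ?expR_gt0//.
  rewrite /partition_function (bigD1 j)//= lerDl sumr_ge0// => i _.
  by rewrite mulr_ge0 ?expR_ge0 ?ltW.
move=> /[swap] /le_trans/[apply].
by rewrite pmulr_rle0// pmulr_lle0 ?invr_gt0.
Qed.

End Gibbs.

(** * Bounds on the robust Bellman operator *)

Section BellmanBounds.
Variables (R : realType) (S A : nat) (M : rmdp R S A).
Implicit Types (v : 'rV[R]_S) (s : 'I_S) (y : R).

Definition payoff v s (a : 'I_A) (j : 'I_S) : R :=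
  reward M s a j + discount M * v 0 j.

Lemma nominal_row_gt0 s a j : 0 < row a (nominal M s) 0 j.
Proof. by rewrite mxE; exact: nominal_gt0. Qed.

Lemma nominal_ambiguity s : ambiguity M s (nominal M s).
Proof.
split=> [a|]; first exact: nominal_simplex.
rewrite big1 => [|a _]; first exact/ltW/budget_gt0.
by apply: divergence_refl => j; exact: nominal_row_gt0.
Qed.

Lemma delta_simplex n (i : 'I_n) : @simplex R n (delta_mx 0 i).
Proof.
split=> [j|]; first by rewrite mxE eqxx; case: eqP.
rewrite (bigD1 i)//= big1 => [|j /negPf ji]; last by rewrite mxE eqxx ji.
by rewrite mxE !eqxx addr0.
Qed.

Section Value.
Variables (v : 'rV[R]_S) (s : 'I_S).
Hypothesis payoff_ge0 : forall a j, 0 <= payoff v s a j.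

Lemma expected_value_ge0 pi p : simplex pi -> ambiguity M s p ->
  0 <= expected_value M v s pi p.
Proof.
move=> [pi0 _] [ps _]; apply: sumr_ge0 => a _; rewrite mulr_ge0//.
apply: sumr_ge0 => j _; rewrite mulr_ge0 ?payoff_ge0//.
by have := (ps a).1 j; rewrite mxE.
Qed.

Lemma inf_expected_value_le pi p : simplex pi -> ambiguity M s p ->
  inf [set expected_value M v s pi p | p in ambiguity M s] <=
  expected_value M v s pi p.
Proof.
move=> spi sp; apply: ge_inf; last by exists p.
by exists 0 => _ [p' sp' <-]; exact: expected_value_ge0.
Qed.

(** One transition model answers every policy: it bounds each inner infimum, and averaging over the
    policy keeps the bound. A positive number of actions makes the outer supremum range over a
    nonempty set. *)
Lemma bellman_le p y : (0 < A)%N -> ambiguity M s p ->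
  (forall a, \sum_j p a j * payoff v s a j <= y) -> bellman M v 0 s <= y.
Proof.
move=> A0 sp py; rewrite mxE; apply: ge_sup.
  by exists (inf [set expected_value M v s (delta_mx 0 (Ordinal A0)) p |
    p in ambiguity M s]), (delta_mx 0 (Ordinal A0)) => //; exact: delta_simplex.
move=> _ [pi spi <-]; apply: le_trans (inf_expected_value_le spi sp) _.
rewrite -[y]mul1r -spi.2 mulr_suml; apply: ler_sum => a _.
exact: ler_wpM2l (spi.1 a) _ _ (py a).
Qed.

Lemma le_bellman pi y : simplex pi ->
  (forall p, ambiguity M s p -> y <= expected_value M v s pi p) ->
  y <= bellman M v 0 s.
Proof.
move=> spi ypi; rewrite mxE.
apply: (@le_trans _ _
    (inf [set expected_value M v s pi p | p in ambiguity M s])).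
  apply: lb_le_inf => [|_ [p sp <-]]; last exact: ypi.
  by exists (expected_value M v s pi (nominal M s)), (nominal M s) => //;
    exact: nominal_ambiguity.
apply: ub_le_sup; last by exists pi.
(* The supremum needs some upper bound on all inner infima: the nominal model, with each policy
   weight replaced by 1. *)
exists (\sum_a \sum_j nominal M s a j * payoff v s a j) => _ [pi' spi' <-].
apply: le_trans (inf_expected_value_le spi' (nominal_ambiguity s)) _.
apply: ler_sum => a _; rewrite ler_piMl//.
  by apply: sumr_ge0 => j _; rewrite mulr_ge0 ?payoff_ge0// ltW ?nominal_gt0.
rewrite -spi'.2 (bigD1 a)//= lerDl; apply: sumr_ge0 => i _; exact: spi'.1.
Qed.

Lemma bellman_ge0 : (0 < A)%N -> 0 <= bellman M v 0 s.
Proof.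
move=> A0; apply: (@le_bellman (delta_mx 0 (Ordinal A0))) => [|p sp].
  exact: delta_simplex.
by apply: expected_value_ge0 => //; exact: delta_simplex.
Qed.

Lemma le_bellman_action a y : (forall j, y <= payoff v s a j) ->
  y <= bellman M v 0 s.
Proof.
move=> yb; apply: (le_bellman (delta_simplex a)) => p [ps _].
rewrite /expected_value (bigD1 a)//= [X in _ + X]big1 => [|i /negPf ia];
  last by rewrite !mxE eqxx ia mul0r.
rewrite mxE !eqxx mul1r addr0 -[y]mul1r.
have [p0 <-] := ps a; rewrite mulr_suml; apply: ler_sum => j _.
by have := p0 j; rewrite !mxE => pj; apply: ler_wpM2l (yb j).
Qed.

Lemma bellman_le_payoff y : (0 < A)%N -> (forall a j, payoff v s a j <= y) ->
  bellman M v 0 s <= y.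
Proof.
move=> A0 le_y; apply: (bellman_le A0 (nominal_ambiguity s)) => a.
have [q0 q1] := nominal_simplex M s a.
rewrite -[y]mul1r -q1 mulr_suml; apply: ler_sum => j _.
by rewrite mxE; apply: ler_wpM2l (le_y a j); exact/ltW/nominal_gt0.
Qed.

(* Weak duality at the Lagrange multipliers [al]: normalising them yields a
   policy whose worst case is bounded below by Gibbs' inequality. *)
Lemma weak_duality (al : 'I_A -> R) (th e : R) : (forall a, 0 <= al a) ->
  0 < \sum_a al a ->
  budget M <= \sum_a free_energy (row a (nominal M s))
                       (fun j => payoff v s a j - th) (al a) +
              e * \sum_a al a ->
  th - e <= bellman M v 0 s.
Proof.
move=> al0; set T := \sum_a al a => T0 hyp.
have spi : simplex (\row_a (al a / T)).
  split=> [a|]; first by rewrite mxE; apply: divr_ge0 (al0 a) (ltW T0).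
  by under eq_bigr do rewrite mxE; rewrite -mulr_suml divff ?gt_eqF.
apply: (le_bellman spi) => p [ps pd].
have -> : expected_value M v s (\row_a (al a / T)) p =
    (\sum_a al a * \sum_j p a j * payoff v s a j) / T.
  by rewrite mulr_suml; apply: eq_bigr => a _; rewrite mxE; ring.
rewrite ler_pdivlMr//.
have -> : \sum_a al a * \sum_j p a j * payoff v s a j =
    \sum_a al a * \sum_j row a p 0 j * (payoff v s a j - th) + th * T.
  rewrite mulr_sumr -big_split; apply: eq_bigr => a _ /=.
  under [X in _ = _ * X + _]eq_bigr do rewrite mulrBr.
  rewrite sumrB -mulr_suml (ps a).2 mul1r mulrBr [th * _]mulrC subrK.
  by under [in RHS]eq_bigr do rewrite mxE.
have : \sum_a free_energy (row a (nominal M s))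
                (fun j => payoff v s a j - th) (al a) -
    \sum_a al a * \sum_j row a p 0 j * (payoff v s a j - th) <= budget M.
  apply: le_trans pd; rewrite -sumrB; apply: ler_sum => a _.
  apply: gibbs_variational => //; first exact: nominal_simplex.
  exact: nominal_row_gt0.
lra.
Qed.

End Value.

(** * Bounds in terms of [Rbar] and [min_nominal] *)

Lemma reward_le_Rbar s a j : reward M s a j <= (1 - discount M) * Rbar M.
Proof.
have l1 := discount_lt1 M.
rewrite /Rbar mulrA divff ?mul1r; last by rewrite gt_eqF// subr_gt0.
by apply: bigmax_sup => //; apply: bigmax_sup => //; exact: le_bigmax.
Qed.

Lemma Rbar_ge0 : 0 <= Rbar M.
Proof.
have l1 := discount_lt1 M.
apply: mulr_ge0; last exact: bigmax_ge_id.
by rewrite invr_ge0 subr_ge0 ltW.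
Qed.

Lemma payoff_le_Rbar v s : (forall j, v 0 j <= Rbar M) ->
  forall a j, payoff v s a j <= Rbar M.
Proof.
move=> vR a j; have := reward_le_Rbar s a j; rewrite /payoff.
have : discount M * v 0 j <= discount M * Rbar M.
  by rewrite ler_wpM2l// ltW ?discount_gt0.
lra.
Qed.

(** The box [0, [Rbar]] is invariant under [bellman], because rewards are at most
    [(1 - discount M) * Rbar M]. The iteration started at 0 stays in it, and the bound passes to the
    limit. *)
Lemma value_limit_le vstar : (0 < A)%N -> is_value_limit M vstar ->
  forall s, vstar 0 s <= Rbar M.
Proof.
move=> A0 /(_ 0) cv s.
have iterP t : forall s, 0 <= iter t (bellman M) 0 0 s <= Rbar M.
  elim: t => [|t IH] {}s /=; first by rewrite mxE lexx Rbar_ge0.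
  set w := iter t _ _ in IH *.
  have w0 a j : 0 <= payoff w s a j.
    rewrite addr_ge0 ?reward_ge0// mulr_ge0 ?(ltW (discount_gt0 _))//.
    by case/andP: (IH j).
  rewrite bellman_ge0//= bellman_le_payoff//.
  by apply: payoff_le_Rbar => j; case/andP: (IH j).
have cvs : iter t (bellman M) 0 0 s @[t --> \oo] --> vstar 0 s.
  apply: (@continuous_cvg _ _ _ _ _ _ (fun u : 'rV[R]_S => u 0 s) _ _ cv).
  exact: coord_continuous.
have cl : closed [set x : R | x <= Rbar M] by exact: closed_le.
apply: (closed_cvg _ cl _ _ cvs).
by near=> t; rewrite /=; case/andP: (iterP t s).
Unshelve. all: by end_near. Qed.

Lemma min_nominal_le s a j : min_nominal M <= nominal M s a j.
Proof.
by apply: bigmin_inf => //; apply: bigmin_inf => //; exact: bigmin_le.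
Qed.

Lemma min_nominal_gt0 : 0 < min_nominal M.
Proof.
rewrite /min_nominal; do 3!(apply/bigmin_gtP; split=> // ? _).
exact: nominal_gt0.
Qed.

End BellmanBounds.

(** * Program logic with running times *)

Fixpoint imod (c : cmd) : seq nat :=
  match c with
  | SetI i _ => [:: i]
  | Seq c1 c2 | If _ c1 c2 => imod c1 ++ imod c2
  | While _ c1 => imod c1
  | _ => [::]
  end.

Fixpoint rmod (c : cmd) : seq nat :=
  match c with
  | SetR i _ => [:: i]
  | Seq c1 c2 | If _ c1 c2 => rmod c1 ++ rmod c2
  | While _ c1 => rmod c1
  | _ => [::]
  end.

Fixpoint amod (c : cmd) : seq nat :=
  match c with
  | Store k _ _ => [:: k]
  | Seq c1 c2 | If _ c1 c2 => amod c1 ++ amod c2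
  | While _ c1 => amod c1
  | _ => [::]
  end.

(** The bound [e] is evaluated anew at every test, so [run_For] asks that the loop leave its value
    unchanged. *)
Definition For (i : nat) (e : iexp) (c : cmd) : cmd :=
  Seq (SetI i (ICst 0))
    (While (BNot (BILe e (IVar i))) (Seq c (SetI i (IAdd (IVar i) (ICst 1))))).

Section ProgramLogic.
Variable R : realType.
Implicit Types (st : memory R) (c : cmd) (Q : memory R -> Prop).

(** Written registers are over-approximated syntactically, and an array counts as written as soon as
    one of its cells may be. *)
Record frame c st st' : Prop := Frame {
  frameI : forall i, i \notin imod c -> ireg st' i = ireg st i;
  frameR : forall i, i \notin rmod c -> rreg st' i = rreg st i;
  frameA : forall k i, k \notin amod c -> arr st' k i = arr st k i }.

Lemma frame_refl c st : frame c st st.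
Proof. by []. Qed.

Lemma frame_trans c st1 st2 st3 :
  frame c st1 st2 -> frame c st2 st3 -> frame c st1 st3.
Proof.
move=> [i1 r1 a1] [i2 r2 a2].
by split=> [i im|i im|k i km]; [rewrite i2 ?i1|rewrite r2 ?r1|rewrite a2 ?a1].
Qed.

Lemma frame_sub c c' st st' : {subset imod c <= imod c'} ->
  {subset rmod c <= rmod c'} -> {subset amod c <= amod c'} ->
  frame c st st' -> frame c' st st'.
Proof.
move=> si sr sa [fi fr fa].
by split=> [i /(contra (si i))|i /(contra (sr i))|k i /(contra (sa k))];
  [exact: fi|exact: fr|exact: fa].
Qed.

Lemma exec_frame c st t st' : exec c st t st' -> frame c st st'.
Proof.
have catl (r1 r2 : seq nat) : {subset r1 <= r1 ++ r2}.
  by move=> x xr; rewrite mem_cat xr.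
have catr (r1 r2 : seq nat) : {subset r2 <= r1 ++ r2}.
  by move=> x xr; rewrite mem_cat xr orbT.
elim=> {c st t st'} //.
- by move=> st i e; split=> // j; rewrite inE /= => /negPf ->.
- by move=> st i e; split=> // j; rewrite inE /= => /negPf ->.
- by move=> st k e x; split=> // k' j; rewrite inE /= => /negPf ->.
- move=> st1 st2 st3 t1 t2 c1 c2 _ f1 _ f2.
  apply: (@frame_trans _ _ st2).
    by apply: frame_sub f1; exact: catl.
  by apply: frame_sub f2; exact: catr.
- by move=> st st' t b c1 c2 _ _; apply: frame_sub; exact: catl.
- by move=> st st' t b c1 c2 _ _; apply: frame_sub; exact: catr.
- move=> st1 st2 st3 t1 t2 b c _ _ f1 _ f2.
  by apply: (frame_trans _ f2); apply: frame_sub f1.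
Qed.

(** Total correctness with a time budget; placing a [run] in the postcondition of another one
    sequences the commands. *)
Definition run c st (T : nat) Q :=
  exists t st', [/\ exec c st t st', (t <= T)%N & Q st'].

Lemma run_frame c st T Q :
  run c st T Q -> run c st T (fun st' => frame c st st' /\ Q st').
Proof.
move=> [t [st' [e tT q]]]; exists t, st'.
by split=> //; split=> //; exact: exec_frame e.
Qed.

Lemma run_weaken c st T T' Q Q' : run c st T Q -> (T <= T')%N ->
  (forall st', Q st' -> Q' st') -> run c st T' Q'.
Proof.
move=> [t [st' [e tT q]]] TT QQ; exists t, st'.
by split=> //; [exact: leq_trans TT | exact: QQ].
Qed.

Lemma run_le c st T T' Q : run c st T Q -> (T <= T')%N -> run c st T' Q.
Proof. by move=> /run_weaken h /h; apply. Qed.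

Lemma run_SetI st i e Q :
  Q (set_ireg st i (ieval st e)) -> run (SetI i e) st (icost e).+1 Q.
Proof. by move=> q; eexists; eexists; split; [exact: ExecSetI| |exact: q]. Qed.

Lemma run_SetR st i x Q :
  Q (set_rreg st i (reval st x)) -> run (SetR i x) st (rcost x).+1 Q.
Proof. by move=> q; eexists; eexists; split; [exact: ExecSetR| |exact: q]. Qed.

Lemma run_Store st k e x Q : Q (set_arr st k (ieval st e) (reval st x)) ->
  run (Store k e x) st (icost e + rcost x).+1 Q.
Proof. by move=> q; eexists; eexists; split; [exact: ExecStore| |exact: q]. Qed.

Lemma run_Skip st Q : Q st -> run Skip st 1 Q.
Proof. by move=> q; eexists; eexists; split; [exact: ExecSkip| |exact: q]. Qed.

Lemma run_Seq c1 c2 st T1 T2 Q :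
  run c1 st T1 (fun st' => run c2 st' T2 Q) -> run (Seq c1 c2) st (T1 + T2) Q.
Proof.
move=> [t1 [st1 [e1 tT1 [t2 [st2 [e2 tT2 q]]]]]].
exists (t1 + t2)%N, st2; split=> //; first exact: ExecSeq e1 e2.
exact: leq_add.
Qed.

(** The rule for subroutines: the specification of [c1] comes with its frame, so facts that [P] does
    not mention survive the call. *)
Lemma run_call c1 c2 st T1 T2 P Q : run c1 st T1 P ->
  (forall st', frame c1 st st' -> P st' -> run c2 st' T2 Q) ->
  run (Seq c1 c2) st (T1 + T2) Q.
Proof.
move=> r1 r2; apply: run_Seq; apply: run_weaken (run_frame r1) (leqnn _) _.
by move=> st' [f p]; exact: r2.
Qed.

Lemma run_If b c1 c2 st T Q : (beval st b -> run c1 st T Q) ->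
  (~~ beval st b -> run c2 st T Q) -> run (If b c1 c2) st (bcost b + T).+1 Q.
Proof.
move=> rT rF; case: (boolP (beval st b)) => bst.
  have [t [st' [e tT q]]] := rT bst; exists (bcost b + t).+1, st'.
  by split=> //; [exact: ExecIfT | rewrite ltnS leq_add2l].
have [t [st' [e tT q]]] := rF bst; exists (bcost b + t).+1, st'.
by split=> //; [exact: ExecIfF | rewrite ltnS leq_add2l].
Qed.

(* [I k] is the invariant of a state from which the loop is known to stop
   after at most [k] more iterations. *)
Lemma run_While b c st k T (I : nat -> memory R -> Prop) : I k st ->
  (forall st', frame c st st' -> I 0%N st' -> ~~ beval st' b) ->
  (forall j st', frame c st st' -> I j.+1 st' -> beval st' b ->
     run c st' T (I j)) ->
  run (While b c) st ((bcost b).+1 + k * (T + (bcost b).+1))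
    (fun st' => (exists j, I j st') /\ ~~ beval st' b).
Proof.
move=> Ik I0 IS; have := frame_refl c st.
elim: k {-2}st Ik => [|k IH] st1 Ik f1; last first.
  case: (boolP (beval st1 b)) => bst.
    have [t [st2 [e tT q]]] := IS k st1 f1 Ik bst.
    have [|t' [st3 [e' tT' q']]] := IH _ q.
      by apply: frame_trans f1 _; exact: exec_frame e.
    exists (bcost b + t + t').+1, st3.
    split=> //; first exact: ExecWhileT e e'.
    by rewrite mulSn; lia.
  exists (bcost b).+1, st1.
  by split; [exact: ExecWhileF | exact: leq_addr | split=> //; exists k.+1].
exists (bcost b).+1, st1; split; [|exact: leq_addr|].
  by apply: ExecWhileF; exact: I0.
by split; [exists 0%N | exact: I0].
Qed.

Lemma run_For i e c st n T (I : nat -> memory R -> Prop) :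
  i \notin imod c ->
  (forall st', frame (For i e c) st st' -> ieval st' e = n) ->
  I 0%N (set_ireg st i 0) ->
  (forall k st', (k < n)%N -> frame (For i e c) st st' -> ireg st' i = k ->
     I k st' -> run c st' T (fun st'' => I k.+1 (set_ireg st'' i k.+1))) ->
  run (For i e c) st (n.+1 * (T + icost e + 8)) (I n).
Proof.
move=> ic en I0 IS; set F := For i e c.
(* [run_While] counts the remaining iterations, whereas [I] counts the completed ones; [J]
   translates between the two. *)
pose J k st' := [/\ frame F st st', (k <= n)%N, ireg st' i = (n - k)%N &
  I (n - k)%N st'].
have iF st' x : frame F st st' -> frame F st (set_ireg st' i x).
  move=> f; apply: frame_trans f _; split=> // j.
  by rewrite /= inE negb_or => /andP[/negPf ->].
have cF st1 st2 : frame c st1 st2 -> frame F st1 st2.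
  by apply: frame_sub => x xc //; rewrite /= ?inE mem_cat xc ?orbT.
(* A pass costs [T], plus 4 for the increment, plus [icost e + 4] for the test. The extra factor in
   [n.+1] pays for the initialisation and the last test. *)
apply: (@run_weaken _ _ (2 + ((icost e + 1).+3 +
    n * (T + 4 + (icost e + 1).+3))) _ (fun st' => (exists j, J j st') /\
    ~~ beval st' (BNot (BILe e (IVar i))))); last first.
- move=> st' [[j [f jn ij Ij]]] /=; rewrite negbK en// ij => nj.
  by move: Ij; have -> : (n - j)%N = n by lia.
- by rewrite mulSn; lia.
apply: run_Seq; apply: run_SetI => /=.
have f0 := iF _ 0%N (frame_refl F st).
have := @run_While (BNot (BILe e (IVar i)))
  (Seq c (SetI i (IAdd (IVar i) (ICst 1)))) (set_ireg st i 0) n (T + 4) J.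
apply.
- by split=> //; rewrite subnn //= eqxx.
- by move=> st' f' [f _ ij _] /=; rewrite negbK en// ij subn0.
move=> j st' _ [f jn ij Ij] /= _.
apply: run_Seq.
have nj : (n - j.+1 < n)%N by lia.
have [t [st'' [e1 tT q]]] := run_frame (IS _ _ nj f ij Ij).
exists t, st''; split=> //; apply: run_SetI => /=.
have [f' q'] := q.
have -> : (ireg st'' i + 1)%N = (n - j)%N by rewrite (frameI f' ic) ij; lia.
split=> //=.
- by apply: iF; apply: frame_trans f _; exact: cF.
- exact: ltnW.
- by rewrite eqxx.
by move: q'; have -> : (n - j.+1).+1 = (n - j)%N by lia.
Qed.

End ProgramLogic.

(** * Soundness of the bisection on the value *)

Section Bisection.
Variables (R : realType) (S A : nat) (M : rmdp R S A) (v : 'rV[R]_S) (eps : R).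

Definition multiplier_tol : R :=
  budget M * (eps / 2) / (2 * A%:R * Rbar M * Rbar M).

Definition multiplier_max : R :=
  - ln (min_nominal M) / (eps / 2) + multiplier_tol.

(** The budget lowered by [A%:R * multiplier_tol * Rbar M], the total error from stopping the
    bisections on the multipliers early. *)
Definition threshold : R := budget M - budget M * (eps / 2) / (2 * Rbar M).

Definition slope (s : 'I_S) (th : R) (a : 'I_A) : R -> R :=
  tilted_sum (row a (nominal M s)) (fun j => payoff M v s a j - th).

Definition dual (s : 'I_S) (th : R) (a : 'I_A) : R -> R :=
  free_energy (row a (nominal M s)) (fun j => payoff M v s a j - th).

(* [dual] is concave in the multiplier with derivative [slope] up to a positive
   factor, so its maximiser on the nonnegative reals lies in [lo, al]. *)
Definition bracketed (s : 'I_S) (th : R) (a : 'I_A) (al : R) : Prop :=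
  exists lo, [/\ 0 <= lo, lo <= al, al - lo <= multiplier_tol,
    slope s th a al <= 0 & lo = 0 \/ 0 < slope s th a lo].

Hypotheses (A_gt0 : (0 < A)%N) (eps_gt0 : 0 < eps).
Hypothesis eps_lt : eps / 2 < Rbar M.

Lemma Rbar_gt0 : 0 < Rbar M.
Proof. by apply: lt_trans eps_lt; rewrite divr_gt0. Qed.

Lemma multiplier_tol_gt0 : 0 < multiplier_tol.
Proof.
rewrite /multiplier_tol; move: (Rbar M) Rbar_gt0 => B B0.
by rewrite divr_gt0 ?mulr_gt0 ?budget_gt0 ?invr_gt0 ?ltr0n.
Qed.

Lemma min_nominal_le1 : min_nominal M <= 1.
Proof. exact: bigmin_le_id. Qed.

Lemma multiplier_max_gt0 : 0 < multiplier_max.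
Proof.
apply: ltr_wpDl; last exact: multiplier_tol_gt0.
rewrite divr_ge0 ?divr_ge0// ?(ltW eps_gt0)// oppr_ge0 ln_le0//.
exact: min_nominal_le1.
Qed.

Section State.
Variable s : 'I_S.
Hypothesis payoff_ge0 : forall a j, 0 <= payoff M v s a j.
Hypothesis payoff_le : forall a j, payoff M v s a j <= Rbar M.

(** The distributions given by [primal_near_dual] for the separate actions are the rows of one
    model. It lies in the ambiguity set and gives every action a value of at most [th]. *)
Lemma bellman_le_accept (th : R) (al : 'I_A -> R) : 0 <= th <= Rbar M ->
  (forall a, bracketed s th a (al a)) ->
  \sum_a dual s th a (al a) <= threshold -> bellman M v 0 s <= th.
Proof.
move=> /andP[th0 thB] br le.
have B0 := Rbar_gt0.
have /fin_all_exists2[p ps pP] a : exists2 p : 'rV[R]_S, simplex p &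
    \sum_j p 0 j * (payoff M v s a j - th) <= 0 /\
    divergence p (row a (nominal M s)) <=
      dual s th a (al a) + multiplier_tol * Rbar M.
  have [lo [lo0 loal altol Nal Nlo]] := br a.
  apply: (primal_near_dual (nominal_simplex M s a) _ (ltW B0) _ lo0) => //.
    by move=> j; exact: nominal_row_gt0.
  by move=> j; have := payoff_ge0 a j; lra.
pose P := \matrix_(a, j) p a 0 j.
have rowP a : row a P = p a by apply/rowP => j; rewrite !mxE.
apply: (bellman_le payoff_ge0 (p := P) A_gt0); last first.
  move=> a; have [+ _] := pP a.
  under eq_bigr do rewrite mulrBr.
  rewrite sumrB -mulr_suml (ps a).2 mul1r subr_le0.
  by under [X in _ -> X <= _]eq_bigr do rewrite mxE.
split=> [a|]; first by rewrite rowP.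
under eq_bigr do rewrite rowP.
apply: (@le_trans _ _ (\sum_a (dual s th a (al a) + multiplier_tol * Rbar M))).
  by apply: ler_sum => a _; case: (pP a).
rewrite big_split/= sumr_const card_ord -mulr_natl.
(* The accumulated tolerance is exactly the distance from [threshold] to the budget. *)
have -> : A%:R * (multiplier_tol * Rbar M) =
    budget M * (eps / 2) / (2 * Rbar M).
  by rewrite /multiplier_tol; field; rewrite gt_eqF//= pnatr_eq0 -lt0n A_gt0.
by move: le; rewrite /threshold; lra.
Qed.

(** A payoff of [a] below [th - eps / 2] would make the slope at [multiplier_max] nonpositive by
    [tilted_sum_large]. Hence playing [a] alone guarantees [th - eps / 2]. *)
Lemma le_bellman_slope (th : R) (a : 'I_A) : 0 < slope s th a multiplier_max ->
  th - eps / 2 <= bellman M v 0 s.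
Proof.
move=> N0; apply: (le_bellman_action payoff_ge0 (a := a)) => j.
have [//|ltb] := leP (th - eps / 2) (payoff M v s a j).
suff : slope s th a multiplier_max <= 0 by rewrite leNgt N0.
apply: (tilted_sum_large (nominal_simplex M s a) _ (e := eps / 2) (j := j)).
- by move=> i; exact: nominal_row_gt0.
- exact: multiplier_max_gt0.
- rewrite /multiplier_max mulrDl divfK ?gt_eqF ?divr_gt0//.
  apply: ler_wpDr; first by rewrite mulr_ge0 ?ltW ?multiplier_tol_gt0 ?divr_gt0.
  rewrite lerN2 ler_ln ?posrE ?nominal_row_gt0 ?min_nominal_gt0//.
  by rewrite mxE min_nominal_le.
- by lra.
Qed.

(** The dual sum is at most [Rbar M * T], so exceeding the threshold forces [T] above
    [budget M / (2 * Rbar M)]. The gap between threshold and budget is then at most [eps / 2 * T],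
    which is the slack that [weak_duality] tolerates. *)
Lemma le_bellman_reject (th : R) (al : 'I_A -> R) : 0 <= th ->
  (forall a, 0 <= al a) ->
  threshold < \sum_a dual s th a (al a) -> th - eps / 2 <= bellman M v 0 s.
Proof.
move=> th0 al0 lt; have B0 := Rbar_gt0; have k0 := budget_gt0 M.
set T := \sum_a al a.
have dT : \sum_a dual s th a (al a) <= Rbar M * T.
  rewrite mulr_sumr; apply: ler_sum => a _.
  apply: le_trans (free_energy_le (nominal_simplex M s a) _ _ _) _ => [j|].
    exact: nominal_row_gt0.
  rewrite mulrC; apply: ler_wpM2r => //.
  rewrite -[leRHS]mul1r -(nominal_simplex M s a).2 mulr_suml.
  apply: ler_sum => j _; apply: ler_wpM2l; first exact/ltW/nominal_row_gt0.
  by have := payoff_le a j; lra.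
have B2 : 0 < 2 * Rbar M by lra.
have eta : budget M * (eps / 2) / (2 * Rbar M) <= budget M / 2.
  rewrite ler_pdivrMr//.
  suff : 0 <= budget M * (Rbar M - eps / 2) by lra.
  by apply: mulr_ge0; [exact: ltW | rewrite subr_ge0 ltW].
have T0 : budget M / 2 < Rbar M * T.
  by apply: lt_le_trans dT; move: lt; rewrite /threshold; lra.
apply: (weak_duality payoff_ge0 al0).
  by rewrite -/T -(pmulr_rgt0 _ B0); lra.
have : budget M * (eps / 2) / (2 * Rbar M) <= eps / 2 * T.
  rewrite ler_pdivrMr//.
  suff : 0 <= eps / 2 * (Rbar M * T - budget M / 2) by lra.
  by apply: mulr_ge0; [exact/ltW/divr_gt0 | rewrite subr_ge0 ltW].
move: lt; rewrite /threshold /dual -/T; lra.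
Qed.

End State.
End Bisection.

(** * The program *)

Notation iNumS := 0%N (only parsing).
Notation iNumA := 1%N (only parsing).
Notation iState := 2%N (only parsing).
Notation iAct := 3%N (only parsing).
Notation iNext := 4%N (only parsing).
Notation rDiscount := 0%N (only parsing).
Notation rBudget := 1%N (only parsing).
Notation rEps := 2%N (only parsing).
Notation rRbar := 3%N (only parsing).
Notation rMin := 4%N (only parsing).
Notation rTol := 5%N (only parsing).
Notation rMax := 6%N (only parsing).
Notation rLo := 7%N (only parsing).
Notation rHi := 8%N (only parsing).
Notation rTheta := 9%N (only parsing).
Notation rTotal := 10%N (only parsing).
Notation rBad := 11%N (only parsing).
Notation rAlo := 12%N (only parsing).
Notation rAhi := 13%N (only parsing).
Notation rAl := 14%N (only parsing).
Notation rSlope := 15%N (only parsing).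
Notation rZ := 16%N (only parsing).
Notation rHalf := 17%N (only parsing).
Notation rThr := 18%N (only parsing).
Notation rCost := 19%N (only parsing).
Notation rWeight := 20%N (only parsing).

Definition entry : iexp :=
  IAdd (IMul (IAdd (IMul (IVar iState) (IVar iNumA)) (IVar iAct)) (IVar iNumS))
       (IVar iNext).

Definition eval_sums_step : cmd :=
  Seq (SetR rCost (RSub (RAdd (RLoad 1 entry)
                          (RMul (RVar rDiscount) (RLoad 2 (IVar iNext))))
                   (RVar rTheta)))
  (Seq (SetR rWeight (RMul (RLoad 0 entry)
     (RExp (RSub (RCst 0) (RMul (RVar rAl) (RVar rCost))))))
  (Seq (SetR rSlope (RAdd (RVar rSlope) (RMul (RVar rCost) (RVar rWeight))))
       (SetR rZ (RAdd (RVar rZ) (RVar rWeight))))).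

Definition eval_sums : cmd :=
  Seq (SetR rSlope (RCst 0))
  (Seq (SetR rZ (RCst 0)) (For iNext (IVar iNumS) eval_sums_step)).

Definition midpoint (lo hi : nat) : rexp :=
  RDiv (RAdd (RVar lo) (RVar hi)) (RCst 2).

Definition bisect_multiplier : cmd :=
  Seq (SetR rAlo (RCst 0))
  (Seq (SetR rAhi (RVar rMax))
    (While (BNot (BRLe (RSub (RVar rAhi) (RVar rAlo)) (RVar rTol)))
      (Seq (SetR rAl (midpoint rAlo rAhi))
      (Seq eval_sums
        (If (BRLe (RVar rSlope) (RCst 0))
          (SetR rAhi (RVar rAl)) (SetR rAlo (RVar rAl))))))).

(** The sums are evaluated again at the upper end, since the last midpoint may have become the lower
    end. A positive slope there means that [rMax] was too small for this action; [rBad] then makes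
    [test_value] reject the threshold. *)
Definition add_action : cmd :=
  Seq bisect_multiplier
  (Seq (SetR rAl (RVar rAhi))
  (Seq eval_sums
    (If (BRLe (RVar rSlope) (RCst 0))
      (SetR rTotal (RSub (RVar rTotal) (RLog (RVar rZ))))
      (SetR rBad (RCst 1))))).

Definition test_value : cmd :=
  Seq (SetR rTheta (midpoint rLo rHi))
  (Seq (SetR rTotal (RCst 0))
  (Seq (SetR rBad (RCst 0))
  (Seq (For iAct (IVar iNumA) add_action)
    (If (BAnd (BRLe (RVar rBad) (RCst 0)) (BRLe (RVar rTotal) (RVar rThr)))
      (SetR rHi (RVar rTheta)) (SetR rLo (RVar rTheta)))))).

Definition bisect_value : cmd :=
  Seq (SetR rLo (RCst 0))
  (Seq (SetR rHi (RVar rRbar))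
    (While (BNot (BRLe (RSub (RVar rHi) (RVar rLo)) (RVar rHalf))) test_value)).

Definition all_states : cmd :=
  For iState (IVar iNumS) (Seq bisect_value (Store 3 (IVar iState) (RVar rHi))).

Definition scan_step : cmd :=
  Seq (If (BRLe (RLoad 1 (IVar iNext)) (RVar rRbar)) Skip
        (SetR rRbar (RLoad 1 (IVar iNext))))
      (If (BRLe (RVar rMin) (RLoad 0 (IVar iNext))) Skip
        (SetR rMin (RLoad 0 (IVar iNext)))).

Definition preprocess : cmd :=
  Seq (SetR rRbar (RCst 0))
  (Seq (SetR rMin (RCst 1))
  (Seq (For iNext (IMul (IMul (IVar iNumS) (IVar iNumA)) (IVar iNumS))
         scan_step)
  (Seq (SetR rThr (RCst 0))
  (* Real expressions cannot read integer registers, so the number of actions is counted up as a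
     real in [rThr], which receives the threshold only at the end. *)
  (Seq (For iAct (IVar iNumA) (SetR rThr (RAdd (RVar rThr) (RCst 1))))
  (Seq (SetR rRbar (RMul (RDiv (RCst 1) (RSub (RCst 1) (RVar rDiscount)))
                         (RVar rRbar)))
  (Seq (SetR rHalf (RDiv (RVar rEps) (RCst 2)))
  (Seq (SetR rTol (RDiv (RMul (RVar rBudget) (RVar rHalf))
     (RMul (RMul (RMul (RCst 2) (RVar rThr)) (RVar rRbar)) (RVar rRbar))))
  (Seq (SetR rMax (RAdd (RDiv (RSub (RCst 0) (RLog (RVar rMin))) (RVar rHalf))
                        (RVar rTol)))
       (SetR rThr (RSub (RVar rBudget)
          (RDiv (RMul (RVar rBudget) (RVar rHalf))
                (RMul (RCst 2) (RVar rRbar))))))))))))).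

Definition robust_bellman : cmd := Seq preprocess all_states.

(** * Correctness of the program *)

Lemma sum_ordS (V : nmodType) n k (kn : (k < n)%N) (F : 'I_n -> V) :
  \sum_(j < n | (j < k.+1)%N) F j =
  \sum_(j < n | (j < k)%N) F j + F (Ordinal kn).
Proof.
rewrite (bigD1 (Ordinal kn))//= addrC; congr (_ + _).
by apply: eq_bigl => j; rewrite -val_eqE /= ltnS andbC ltn_neqAle.
Qed.

Section Correctness.
Variables (R : realType) (S A : nat) (M : rmdp R S A) (v : 'rV[R]_S) (eps : R).
Implicit Types (st : memory R).

Lemma encodes_frame c st st' : frame c st st' ->
  [&& 0 \notin imod c, 1 \notin imod c, 0 \notin rmod c, 1 \notin rmod c
    & 2 \notin rmod c] ->
  [&& 0 \notin amod c, 1 \notin amod c & 2 \notin amod c] ->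
  encodes M v eps st -> encodes M v eps st'.
Proof.
move=> [fi fr fa] /and5P[i0 i1 r0 r1 r2] /and3P[a0 a1 a2].
by case=> *; split=> *; rewrite ?fi ?fr ?fa.
Qed.

Definition sums_of (s : 'I_S) (th : R) (a : 'I_A) (al : R) st : Prop :=
  rreg st rSlope = slope M v s th a al /\
  - ln (rreg st rZ) = dual M v s th a al.

Lemma run_eval_sums st (s : 'I_S) (a : 'I_A) : encodes M v eps st ->
  ireg st iState = s -> ireg st iAct = a ->
  run eval_sums st (S.+1 * 80)
    (sums_of s (rreg st rTheta) a (rreg st rAl)).
Proof.
move=> enc ss sa; rewrite /eval_sums.
pose th := rreg st rTheta; pose al := rreg st rAl.
pose c j := payoff M v s a j - th.
pose w j := row a (nominal M s) 0 j * expR (- (al * c j)).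
apply: (run_weaken (T := (2 + (2 + S.+1 * (60 + 1 + 8)))%N)
  (Q := fun st' => rreg st' rSlope = \sum_(j < S | (j < S)%N) c j * w j /\
                   rreg st' rZ = \sum_(j < S | (j < S)%N) w j)); last first.
- move=> st' [N Z]; rewrite /sums_of /slope /dual /tilted_sum /free_energy.
  by split; rewrite ?N ?Z; [|congr (- ln _)]; apply: eq_bigl => j;
    rewrite ltn_ord.
- by lia.
apply: run_Seq; apply: run_SetR => /=; apply: run_Seq; apply: run_SetR => /=.
set st0 := set_rreg _ _ _.
have e0 : encodes M v eps st0 by case: enc.
apply: (run_For (I := fun k st' =>
  rreg st' rSlope = \sum_(j < S | (j < k)%N) c j * w j /\
  rreg st' rZ = \sum_(j < S | (j < k)%N) w j)) => //.
- by move=> st' f /=; rewrite (frameI f)//; case: e0.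
- by rewrite /= !big1.
move=> k st' kS f jk [N Z].
have [eS eA eD _ _ eq er ev] := encodes_frame f isT isT e0.
have fs : ireg st' iState = s by rewrite (frameI f).
have fa : ireg st' iAct = a by rewrite (frameI f).
have fth : rreg st' rTheta = th by rewrite (frameR f).
have fal : rreg st' rAl = al by rewrite (frameR f).
have cE : arr st' 1 (((s * A + a) * S) + k)%N + discount M * arr st' 2 k - th =
    c (Ordinal kS).
  by rewrite (er s a (Ordinal kS)) (ev (Ordinal kS)).
have qE : arr st' 0 (((s * A + a) * S) + k)%N =
    row a (nominal M s) 0 (Ordinal kS).
  by rewrite (eq s a (Ordinal kS)) mxE.
apply: (run_le (T := (18 + (18 + (6 + 4)))%N)) => //.
apply: run_Seq; apply: run_SetR => /=; rewrite fs fa eS eA jk eD fth cE.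
apply: run_Seq; apply: run_SetR => /=; rewrite fs fa eS eA jk fal qE sub0r.
rewrite -/(w _).
apply: run_Seq; apply: run_SetR => /=; apply: run_SetR => /=.
by rewrite !(sum_ordS kS) N Z.
Qed.

Definition ready st : Prop := encodes M v eps st /\
  [/\ rreg st rRbar = Rbar M, rreg st rTol = multiplier_tol M eps,
      rreg st rMax = multiplier_max M eps, rreg st rHalf = eps / 2
    & rreg st rThr = threshold M eps].

(** A boolean check on the syntax, so that preservation of [ready] by a concrete command is settled
    by computation. *)
Definition keeps_ready c : bool :=
  [&& all [predC imod c] [:: iNumS; iNumA],
      all [predC rmod c]
        [:: rDiscount; rBudget; rEps; rRbar; rTol; rMax; rHalf; rThr]
    & all [predC amod c] [:: 0; 1; 2]].

Lemma ready_frame c st st' :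
  frame c st st' -> keeps_ready c -> ready st -> ready st'.
Proof.
move=> f /and3P[] /=.
rewrite !andbT => /andP[i0 i1].
move=> /and5P[r0 r1 r2 r3 /and4P[r5 r6 r17 r18]] /and3P[a0 a1 a2] [enc par].
split; last by rewrite !(frameR f).
by apply: encodes_frame f _ _ enc; apply/and5P || apply/and3P.
Qed.

Lemma ready_set_rreg st i x :
  i \notin [:: rDiscount; rBudget; rEps; rRbar; rTol; rMax; rHalf; rThr] ->
  ready st -> ready (set_rreg st i x).
Proof.
move=> im; apply: (ready_frame (c := SetR i (RCst 0))).
  by split=> // j; rewrite inE /= => /negPf ->.
rewrite /keeps_ready /= !inE; move: im; rewrite !inE; lia.
Qed.

(** * Reading the instance and computing its parameters *)

Lemma entry_lt (s : 'I_S) (a : 'I_A) (j : 'I_S) :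
  ((s * A + a) * S + j < S * A * S)%N.
Proof.
have /andP[s1 a1] : (s < S)%N && (a < A)%N by rewrite !ltn_ord.
have sa : (s * A + a < S * A)%N.
  by apply: (@leq_trans (s.+1 * A)); rewrite ?leq_mul2r ?s1 ?orbT// mulSn; lia.
apply: (@leq_trans ((s * A + a).+1 * S)); last by rewrite leq_mul2r sa orbT.
by rewrite [X in (_ < X)%N]mulSn addnC ltn_add2r.
Qed.

(** Decoding by two Euclidean divisions. With [entry_lt] it shows that a single loop over flat
    indices visits exactly the entries of the instance. *)
Lemma entryP k : (k < S * A * S)%N -> exists (s : 'I_S) (a : 'I_A) (j : 'I_S),
  k = ((s * A + a) * S + j)%N.
Proof.
move=> kn.
have S0 : (0 < S)%N by case: S kn; rewrite ?muln0.
have A0 : (0 < A)%N by case: A kn; rewrite ?muln0.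
have jS : (k %% S < S)%N by rewrite ltn_mod.
have aA : (k %/ S %% A < A)%N by rewrite ltn_mod.
have sS : (k %/ S %/ A < S)%N by rewrite !ltn_divLR.
by exists (Ordinal sS), (Ordinal aA), (Ordinal jS); rewrite /= -!divn_eq.
Qed.

Lemma run_scan st :
  encodes M v eps st -> rreg st rRbar = 0 -> rreg st rMin = 1 ->
  run (For iNext (IMul (IMul (IVar iNumS) (IVar iNumA)) (IVar iNumS)) scan_step)
    st ((S * A * S).+1 * 30)
    (fun st' => rreg st' rRbar =
        \big[Num.max/0]_s \big[Num.max/0]_a \big[Num.max/0]_s'
          reward M s a s' /\
      rreg st' rMin = min_nominal M).
Proof.
move=> enc R0 m1; set Rm := \big[_/_]_s _.
(* Each register stays on the correct side of the true extremum and dominates the entries seen so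
   far; after the last entry, antisymmetry gives equality. *)
pose I k st' :=
  [/\ 0 <= rreg st' rRbar, rreg st' rRbar <= Rm,
      forall i, (i < k)%N -> arr st 1 i <= rreg st' rRbar &
      [/\ min_nominal M <= rreg st' rMin, rreg st' rMin <= 1 &
          forall i, (i < k)%N -> rreg st' rMin <= arr st 0 i]].
apply: (@run_weaken _ _ _ ((S * A * S).+1 * (16 + 5 + 8))%N _
  (I (S * A * S)%N)).
- apply: (run_For (I := I)) => //.
  + by move=> st' f /=; rewrite !(frameI f)//; case: enc => -> ->.
  + split; rewrite /= ?R0 ?m1//.
      by apply: bigmax_ge_id.
    by split=> //; exact: bigmin_le_id.
  move=> k st' kn f jk [R'0 R'm R'k [m'm m'1 m'k]].
  have [s [a [j kE]]] := entryP kn.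
  have rk : arr st 1 k = reward M s a j by rewrite kE; case: enc.
  have qk : arr st 0 k = nominal M s a j by rewrite kE; case: enc.
  have rm : reward M s a j <= Rm.
    by apply: bigmax_sup => //; apply: bigmax_sup => //; exact: le_bigmax.
  have a1 : arr st' 1 k = arr st 1 k by rewrite (frameA f).
  have a0 : arr st' 0 k = arr st 0 k by rewrite (frameA f).
  have r0 := reward_ge0 M s a j.
  have [q0 q1] : min_nominal M <= arr st 0 k /\ arr st 0 k <= 1.
    split; first by rewrite qk min_nominal_le.
    have [p0 <-] := nominal_simplex M s a; rewrite (bigD1 j)//= mxE qk lerDl.
    exact: sumr_ge0.
  (* The state between the two conditionals: the maximum has taken entry [k] into account, the
     minimum has not yet. *)
  pose J st'' := arr st'' 0 k = arr st 0 k /\ ireg st'' iNext = k /\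
   [/\ 0 <= rreg st'' rRbar, rreg st'' rRbar <= Rm,
      forall i, (i < k.+1)%N -> arr st 1 i <= rreg st'' rRbar &
      [/\ min_nominal M <= rreg st'' rMin, rreg st'' rMin <= 1 &
          forall i, (i < k)%N -> rreg st'' rMin <= arr st 0 i]].
  have ext (P : nat -> Prop) : (forall i, (i < k)%N -> P i) -> P k ->
      forall i, (i < k.+1)%N -> P i.
    move=> Pi Pk i; rewrite ltnS leq_eqVlt => /predU1P[->//|]; exact: Pi.
  apply: (run_le (T := (8 + 8)%N)) => //.
  apply: (@run_call _ _ _ _ _ _ J).
    apply: (run_If (T := 3)) => /=; rewrite jk a1 => cmp.
      apply: (run_le (T := 1)) => //; apply: run_Skip; do 2!split=> //.
      by split=> //; exact: ext.
    apply: run_SetR; rewrite /J /= jk a1 rk; do 2!split=> //.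
    split=> //; apply: ext => [i ik|]; last by rewrite rk.
    apply: le_trans (R'k i ik) _; move: cmp; rewrite -ltNge rk; exact: ltW.
  move=> st'' f'' [a0' [jk' [R1 R2 R3 [m2 m3 m4]]]].
  apply: (run_If (T := 3)) => /=; rewrite jk' a0' => cmp.
    apply: (run_le (T := 1)) => //; apply: run_Skip; split=> //=.
    by split=> //; exact: ext.
  apply: run_SetR; rewrite /I /= jk' a0'; split=> //; split=> //.
  apply: ext => // i ik; apply: le_trans (m4 i ik).
  by move: cmp; rewrite -ltNge; exact: ltW.
- by rewrite leq_mul2l orbT.
move=> st' [R'0 R'm R'k [m'm m'1 m'k]]; split; apply/le_anti/andP; split=> //.
  do 3!(apply: bigmax_le => // ? _).
  have [_ _ _ _ _ _ er _] := enc.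
  by rewrite -er; exact/R'k/entry_lt.
do 3!(apply/bigmin_geP; split=> // ? _).
have [_ _ _ _ _ eq _ _] := enc.
by rewrite -eq; exact/m'k/entry_lt.
Qed.

Lemma run_count st : encodes M v eps st -> rreg st rThr = 0 ->
  run (For iAct (IVar iNumA) (SetR rThr (RAdd (RVar rThr) (RCst 1))))
    st (A.+1 * 13) (fun st' => rreg st' rThr = A%:R).
Proof.
move=> enc t0.
apply: (run_le (T := (A.+1 * (4 + 1 + 8))%N)) => //.
apply: (run_For (I := fun k st' => rreg st' rThr = k%:R)) => //.
  by move=> st' f /=; rewrite (frameI f)//; case: enc.
by move=> k st' _ _ _ tk; apply: run_SetR; rewrite /= tk -[RHS]natr1.
Qed.

Lemma run_preprocess st : encodes M v eps st ->
  run preprocess st ((S * A * S).+1 * 30 + A.+1 * 13 + 60) ready.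
Proof.
move=> enc.
apply: (run_le (T := (2 + (2 + ((S * A * S).+1 * 30 + (2 + (A.+1 * 13 +
  (8 + (4 + (12 + (9 + 10)))))))))%N)); last by lia.
do 2!(apply: run_Seq; apply: run_SetR => /=).
set st1 := set_rreg _ _ _.
have e1 : encodes M v eps st1 by case: enc.
apply: (run_call (run_scan e1 erefl erefl)) => st2 f2 [B2 m2].
have e2 : encodes M v eps st2 by exact: encodes_frame f2 _ _ e1.
apply: run_Seq; apply: run_SetR => /=.
set st3 := set_rreg _ _ _.
have e3 : encodes M v eps st3 by case: e2.
apply: (run_call (run_count e3 erefl)) => st4 f4 tA.
have e4 : encodes M v eps st4 by exact: encodes_frame f4 _ _ e3.
have B4 : rreg st4 rRbar = rreg st2 rRbar by rewrite (frameR f4).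
have m4 : rreg st4 rMin = rreg st2 rMin by rewrite (frameR f4).
have [_ _ dE bE eE _ _ _] := e4.
do 4!(apply: run_Seq; apply: run_SetR => /=).
apply: run_SetR => /=; split; first by case: e4.
rewrite /= B4 m4 B2 m2 tA dE bE eE div1r.
by rewrite /threshold /multiplier_max /multiplier_tol /Rbar sub0r.
Qed.

Hypotheses (A_gt0 : (0 < A)%N) (eps_gt0 : 0 < eps).
Hypothesis payoff_ge0 : forall s a j, 0 <= payoff M v s a j.
Hypothesis payoff_le : forall s a j, payoff M v s a j <= Rbar M.

(** * The nested bisections on the multipliers and on the value *)

Variable K : nat.
Hypothesis K_large : eps / 2 < Rbar M ->
  multiplier_max M eps <= multiplier_tol M eps * 2 ^+ K.

(** The bracket with [k] halvings left. Unlike in [bracketed], the upper end may still be the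
    initial one, where the slope has not been evaluated. *)
Definition unchecked_bracket (s : 'I_S) (th : R) (a : 'I_A) (k : nat)
    (lo hi : R) : Prop :=
  [/\ 0 <= lo, lo <= hi, hi - lo <= multiplier_tol M eps * 2 ^+ k,
    hi = multiplier_max M eps \/ slope M v s th a hi <= 0
  & lo = 0 \/ 0 < slope M v s th a lo].

Lemma run_bisect_multiplier st (s : 'I_S) (a : 'I_A) : eps / 2 < Rbar M ->
  ready st -> ireg st iState = s -> ireg st iAct = a ->
  run bisect_multiplier st (K.+1 * (S.+1 * 80 + 30))
    (fun st' => exists lo,
       unchecked_bracket s (rreg st rTheta) a 0 lo (rreg st' rAhi)).
Proof.
move=> epsB rd ss sa; set th := rreg st rTheta.
pose I k st' := ready st' /\
  unchecked_bracket s th a k (rreg st' rAlo) (rreg st' rAhi).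
apply: (@run_weaken _ _ _ (2 + (2 + (7 + K * (6 + (S.+1 * 80 + 6) + 7))))%N _
  (fun st' => (exists k, I k st') /\
     ~~ beval st' (BNot (BRLe (RSub (RVar rAhi) (RVar rAlo)) (RVar rTol))))).
- apply: run_Seq; apply: run_SetR => /=; apply: run_Seq; apply: run_SetR => /=.
  set st0 := set_rreg _ _ _.
  have rd0 : ready st0 by do 2!apply: ready_set_rreg => //.
  apply: (run_While (k := K) (I := I)).
  + split=> //; case: rd0 => _ /= [_ rT rM _ _].
    split=> //=; rewrite ?rM ?subr0//; last 3 first.
    * exact: K_large.
    * by left.
    * by left.
    by apply/ltW/multiplier_max_gt0.
  + by move=> st' _ [[_ [_ rT _ _ _]] [_ _ + _ _]] /=; rewrite rT mulr1 negbK.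
  move=> k st' f [rd' [lo0 lohi wid hib lob]] /=.
  move=> _; apply: run_Seq; apply: run_SetR => /=.
  set mid := (_ + _) / _; set st1 := set_rreg _ _ _.
  have rd1 : ready st1 by exact: ready_set_rreg.
  have s1 : ireg st1 iState = s by rewrite /= (frameI f).
  have a1 : ireg st1 iAct = a by rewrite /= (frameI f).
  have th1 : rreg st1 rTheta = th by rewrite /= (frameR f).
  apply: (run_call (run_eval_sums rd1.1 s1 a1)) => st2 f2 [+ _].
  rewrite th1 /= => N2.
  have rd2 : ready st2 by exact: ready_frame f2 _ rd1.
  have lo2 : rreg st2 rAlo = rreg st' rAlo by rewrite (frameR f2).
  have hi2 : rreg st2 rAhi = rreg st' rAhi by rewrite (frameR f2).
  have mid2 : rreg st2 rAl = mid by rewrite (frameR f2).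
  move: wid; rewrite exprSr => wid.
  apply: run_If => /=; rewrite N2 => Nmid; apply: run_SetR; rewrite /= mid2.
    split; first exact: ready_set_rreg.
    rewrite /= lo2; split=> //; rewrite /mid; lra.
  split; first exact: ready_set_rreg.
  rewrite /= hi2; split=> //; rewrite /mid; lra.
- by rewrite mulSn; lia.
move=> st' [[k [[_ [_ rT _ _ _]] [lo0 lohi _ hib lob]]]] /=.
rewrite negbK rT => wid; exists (rreg st' rAlo); split=> //.
by rewrite mulr1.
Qed.

Lemma run_add_action st (s : 'I_S) (a : 'I_A) : eps / 2 < Rbar M ->
  ready st -> ireg st iState = s -> ireg st iAct = a ->
  run add_action st (K.+2 * (S.+1 * 80 + 30))
    (fun st' => let th := rreg st rTheta in
    (rreg st' rBad = rreg st rBad /\ exists al, bracketed M v eps s th a al /\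
       rreg st' rTotal = rreg st rTotal + dual M v s th a al) \/
    (rreg st' rBad = 1 /\ 0 < slope M v s th a (multiplier_max M eps))).
Proof.
move=> epsB rd ss sa; set th := rreg st rTheta.
apply: (run_le (T := (K.+1 * (S.+1 * 80 + 30) + (2 + (S.+1 * 80 + 9)))%N));
  last by rewrite [X in (_ <= X)%N]mulSn addnC; lia.
apply: (run_call (run_bisect_multiplier epsB rd ss sa)) => st1 f1.
rewrite -/th => -[lo [lo0 lohi]]; rewrite mulr1 => wid hib lob.
apply: run_Seq; apply: run_SetR => /=.
set st2 := set_rreg _ _ _.
have rd2 : ready st2 by apply: ready_set_rreg => //; exact: ready_frame f1 _ rd.
have s2 : ireg st2 iState = s by rewrite /= (frameI f1).
have a2 : ireg st2 iAct = a by rewrite /= (frameI f1).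
have th2 : rreg st2 rTheta = th by rewrite /= (frameR f1).
apply: (run_call (run_eval_sums rd2.1 s2 a2)) => st3 f3.
rewrite th2 /= => -[N3 Z3].
have total3 : rreg st3 rTotal = rreg st rTotal.
  by rewrite (frameR f3)// /= (frameR f1).
have bad3 : rreg st3 rBad = rreg st rBad.
  by rewrite (frameR f3)// /= (frameR f1).
apply: (run_If (T := 5)) => /=; rewrite N3 => Nhi.
  apply: run_SetR => /=; left; split=> //.
  exists (rreg st1 rAhi); split; last by rewrite total3 Z3.
  by exists lo.
apply: (run_le (T := 2)) => //; apply: run_SetR => /=; right; split=> //.
(* A positive slope at the upper end is possible only if that end never moved from
   [multiplier_max]. *)
by case: hib => [<-|hib]; [rewrite ltNge | rewrite hib in Nhi].
Qed.

Lemma run_actions st (s : 'I_S) : eps / 2 < Rbar M ->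
  ready st -> ireg st iState = s ->
  rreg st rBad = 0 -> rreg st rTotal = 0 ->
  run (For iAct (IVar iNumA) add_action) st
    (A.+1 * (K.+2 * (S.+1 * 80 + 30) + 9))
    (fun st' => let th := rreg st rTheta in
    (rreg st' rBad = 0 /\ exists al : 'I_A -> R,
       (forall a, bracketed M v eps s th a (al a)) /\
       rreg st' rTotal = \sum_a dual M v s th a (al a)) \/
    (rreg st' rBad = 1 /\
     exists a, 0 < slope M v s th a (multiplier_max M eps))).
Proof.
move=> epsB rd ss bad0 tot0; set th := rreg st rTheta.
(* Once set, [rBad] stays at 1, and one action with positive slope justifies rejection whatever the
   total is. *)
pose I k st' :=
  (rreg st' rBad = 0 /\ exists al : 'I_A -> R,
     (forall a : 'I_A, (a < k)%N -> bracketed M v eps s th a (al a)) /\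
     rreg st' rTotal = \sum_(a < A | (a < k)%N) dual M v s th a (al a)) \/
  (rreg st' rBad = 1 /\
   exists a, 0 < slope M v s th a (multiplier_max M eps)).
apply: (@run_weaken _ _ _ (A.+1 * (K.+2 * (S.+1 * 80 + 30) + 1 + 8))%N _ (I A)).
- apply: (run_For (I := I)) => //.
  + by move=> st' f /=; rewrite (frameI f)//; case: rd.1.
  + left; split=> //; exists (fun=> 0); split=> //.
    by rewrite /= tot0 big1.
  move=> k st' kA f ak Ik.
  have rd' : ready st' by exact: ready_frame f _ rd.
  have s' : ireg st' iState = s by rewrite (frameI f).
  have th' : rreg st' rTheta = th by rewrite (frameR f).
  have a' : ireg st' iAct = Ordinal kA by [].
  apply: run_weaken (run_add_action epsB rd' s' a') (leqnn _) _ => st''.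
  rewrite th' /= => -[[bad [al [br tot]]]|[bad sl]]; last first.
    by right; split=> //; exists (Ordinal kA).
  case: Ik => [[bad' [al' [br' tot']]]|[bad' ex]]; last first.
    by right; rewrite /= bad bad'.
  left; rewrite /= bad bad'; split=> //.
  exists (fun a : 'I_A => if (a < k)%N then al' a else al); split=> [a|].
    rewrite ltnS; case: ltnP => [ak' _|ka ak']; first exact: br'.
    have -> : a = Ordinal kA by apply/val_inj/eqP; rewrite eqn_leq ak' ka.
    exact: br.
  rewrite (sum_ordS kA) /= ltnn tot tot'; congr (_ + _).
  by apply: eq_bigr => a ->.
- by rewrite -addnA.
move=> st' [[bad [al [br tot]]]|h]; [left | by right].
split=> //; exists al; split=> [a|]; first exact/br/ltn_ord.
by rewrite tot; apply: eq_bigl => a; rewrite ltn_ord.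
Qed.

Lemma run_test_value st (s : 'I_S) : eps / 2 < Rbar M ->
  ready st -> ireg st iState = s ->
  0 <= rreg st rLo -> rreg st rLo <= rreg st rHi -> rreg st rHi <= Rbar M ->
  run test_value st (A.+2 * (K.+2 * (S.+1 * 80 + 30) + 30))
    (fun st' => let th := (rreg st rLo + rreg st rHi) / 2 in
      [/\ rreg st' rLo = rreg st rLo, rreg st' rHi = th
         & bellman M v 0 s <= th] \/
      [/\ rreg st' rLo = th, rreg st' rHi = rreg st rHi
         & th - eps / 2 <= bellman M v 0 s]).
Proof.
move=> epsB rd ss lo0 lohi hiB; set th := _ / 2.
have th0 : 0 <= th by rewrite /th; lra.
have thB : th <= Rbar M by rewrite /th; lra.
apply: (run_le (T := (6 + (2 + (2 +
    (A.+1 * (K.+2 * (S.+1 * 80 + 30) + 9) + 10))))%N)); last first.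
  by rewrite [X in (_ <= X)%N]mulSn; lia.
do 3!(apply: run_Seq; apply: run_SetR => /=).
set st1 := set_rreg _ _ _.
have rd1 : ready st1 by do 3!apply: ready_set_rreg => //.
apply: (run_call (run_actions (s := s) epsB rd1 ss _ _)) => // st2 f2 /=.
have lo2 : rreg st2 rLo = rreg st rLo by rewrite (frameR f2).
have hi2 : rreg st2 rHi = rreg st rHi by rewrite (frameR f2).
have th2 : rreg st2 rTheta = th by rewrite (frameR f2).
have thr2 : rreg st2 rThr = threshold M eps.
  by rewrite (frameR f2)//; case: rd.2.
rewrite -/th => h; apply: run_If => /=; rewrite thr2.
  move=> /andP[bad tot]; apply: run_SetR; rewrite /= th2 lo2; left; split=> //.
  case: h => [[_ [al [br totE]]]|[bad1 _]]; last first.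
    by move: bad; rewrite bad1; lra.
  apply: (bellman_le_accept A_gt0 eps_gt0 epsB _ _ br) => //; first exact/andP.
  by rewrite -totE.
move=> nacc; apply: run_SetR; rewrite /= th2 hi2; right; split=> //.
case: h => [[bad [al [br totE]]]|[_ [a sl]]]; last first.
  exact: (le_bellman_slope A_gt0 eps_gt0 epsB _ sl).
apply: (le_bellman_reject eps_gt0 epsB _ _ (al := al)) => // [a|].
  by have [lo [lo0' loal _ _ _]] := br a; exact: le_trans loal.
by move: nacc; rewrite bad lexx /= -ltNge -totE.
Qed.

Variable L : nat.
Hypothesis L_large : Rbar M <= eps / 2 * 2 ^+ L.

Lemma run_bisect_value st (s : 'I_S) : ready st -> ireg st iState = s ->
  run bisect_value st (L.+1 * (A.+2 * (K.+2 * (S.+1 * 80 + 30) + 30) + 20))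
    (fun st' => `|rreg st' rHi - bellman M v 0 s| <= eps).
Proof.
move=> rd ss; set T := (A.+2 * _)%N.
(* The lower end bounds the value only up to [eps / 2], as that is all a rejection proves. With a
   final width of at most [eps / 2], the upper end is accurate to [eps]. *)
pose I k st' := ready st' /\
  [/\ 0 <= rreg st' rLo, rreg st' rLo <= rreg st' rHi, rreg st' rHi <= Rbar M &
    [/\ rreg st' rHi - rreg st' rLo <= eps / 2 * 2 ^+ k,
        rreg st' rLo - eps / 2 <= bellman M v 0 s &
        bellman M v 0 s <= rreg st' rHi]].
have b0 : 0 <= bellman M v 0 s by apply: bellman_ge0.
have bB : bellman M v 0 s <= Rbar M by apply: bellman_le_payoff.
apply: (@run_weaken _ _ _ (2 + (2 + (7 + L * (T + 7))))%N _
  (fun st' => (exists k, I k st') /\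
     ~~ beval st' (BNot (BRLe (RSub (RVar rHi) (RVar rLo)) (RVar rHalf))))).
- apply: run_Seq; apply: run_SetR => /=; apply: run_Seq; apply: run_SetR => /=.
  set st0 := set_rreg _ _ _.
  have rd0 : ready st0 by do 2!apply: ready_set_rreg => //.
  apply: (run_While (k := L) (I := I)).
  + split=> //; case: rd0 => _ /= [rB _ _ _ _].
    rewrite /= rB subr0; split=> //; first exact: Rbar_ge0.
    by split=> //; apply: le_trans b0; rewrite subr_le0 ltW// divr_gt0.
  + move=> st' _ [[_ [_ _ _ rH _]] [_ _ _ [+ _ _]]] /=.
    by rewrite rH mulr1 negbK.
  move=> k st' f [rd' [lo0 lohi hiB [wid lob hib]]] /=.
  have [_ [_ _ _ -> _]] := rd'; rewrite -ltNge => gap.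
  (* The body runs only while the gap inside [0, [Rbar]] exceeds [eps / 2]; this supplies the
     hypothesis under which the tolerance is positive. *)
  have epsB : eps / 2 < Rbar M by lra.
  have s' : ireg st' iState = s by rewrite (frameI f).
  move: wid; rewrite exprSr => wid.
  apply: run_weaken (run_frame (run_test_value epsB rd' s' lo0 lohi hiB))
    (leqnn _) _ => st'' [f' h].
  split; first exact: ready_frame f' _ rd'.
  by case: h => -[-> -> V]; split=> //; try (split=> //); lra.
- by rewrite mulSn; lia.
move=> st' [[k [[_ [_ _ _ rH _]] [lo0 lohi hiB [_ lob hib]]]]] /=.
by rewrite negbK rH => wid; rewrite ler_norml; apply/andP; split; lra.
Qed.

Lemma run_all_states st : ready st ->
  run all_states st
    (S.+1 * (L.+1 * (A.+2 * (K.+2 * (S.+1 * 80 + 30) + 30) + 20) + 12))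
    (fun st' => forall s : 'I_S, `|arr st' 3 s - bellman M v 0 s| <= eps).
Proof.
move=> rd; set T := (L.+1 * _)%N.
pose I k st' := forall s : 'I_S, (s < k)%N ->
  `|arr st' 3 s - bellman M v 0 s| <= eps.
apply: (@run_weaken _ _ _ (S.+1 * (T + 3 + 1 + 8))%N _ (I S)).
- apply: (run_For (I := I)) => //.
    by move=> st' f /=; rewrite (frameI f)//; case: rd.1.
  move=> k st' kS f sk Ik.
  have rd' : ready st' by exact: ready_frame f _ rd.
  apply: (run_call (run_bisect_value (s := Ordinal kS) rd' sk)) => st'' f' V.
  apply: run_Store => /= s sk1.
  have sk'' : ireg st'' iState = k by rewrite (frameI f').
  rewrite sk'' /=; case: eqVneq => [sE|neq].
    by have -> : s = Ordinal kS by exact: val_inj.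
  by rewrite (frameA f')//; apply: Ik; rewrite ltn_neqAle neq.
- by rewrite leq_mul2l; apply/orP; right; lia.
by move=> st' Is s; exact: Is.
Qed.

Lemma run_robust_bellman st : encodes M v eps st ->
  run robust_bellman st
    ((S * A * S).+1 * 30 + A.+1 * 13 + 60 +
     S.+1 * (L.+1 * (A.+2 * (K.+2 * (S.+1 * 80 + 30) + 30) + 20) + 12))
    (fun st' => `|output S st' - bellman M v| <= eps).
Proof.
move=> enc; apply: (run_call (run_preprocess enc)) => st1 _ rd1.
apply: run_weaken (run_all_states rd1) (leqnn _) _ => st' h.
rewrite [leLHS]/Num.Def.normr /= mx_normrE; apply: bigmax_le => [|[i s] _].
  exact: ltW.
by move: (h s); rewrite /= ord1 !mxE.
Qed.

End Correctness.

(** * Running time *)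

Section Olog.
Variable R : realType.
Implicit Types (x y : R).

Lemma Olog_ge1 x : 1 <= Olog x.
Proof. by rewrite /Olog le_max lexx. Qed.

Lemma ln_le_Olog x : ln x <= Olog x.
Proof. by rewrite /Olog le_max lexx orbT. Qed.

Lemma ln_le_sub1 x : 0 < x -> ln x <= x - 1.
Proof.
by move=> x0; have := expR_ge1Dx (ln x); rewrite lnK ?posrE//; lra.
Qed.

Lemma Olog_double x : 0 <= x -> Olog (2 * x) <= 2 * Olog x.
Proof.
move=> x0; have o1 := Olog_ge1 x; rewrite {1}/Olog ge_max; apply/andP; split.
  by lra.
move: x0; rewrite le_eqVlt => /predU1P[<-|x0].
  by rewrite mulr0 ln0//; have := Olog_ge1 (0 : R); lra.
rewrite lnM ?posrE//; have := ln_le_Olog x.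
by have := @ln_le_sub1 2 ltac:(lra); lra.
Qed.

(** With [m] the maximum of 1 and [x], the argument is at most [9 * (a * m)], whose logarithm is at
    most 8 plus the two factors. Both being at least 1, everything is absorbed into their
    product. *)
Lemma Olog_affine (a x : R) : 1 <= a -> 0 <= x ->
  Olog (8 * a * x + 1) <= 10 * (Olog a * Olog x).
Proof.
move=> a1 x0; have [oa ox] := (Olog_ge1 a, Olog_ge1 x).
have p1 : 1 <= Olog a * Olog x by rewrite mulr_ege1.
have pa : Olog a <= Olog a * Olog x by rewrite ler_peMr//; lra.
have px : Olog x <= Olog a * Olog x by rewrite ler_peMl//; lra.
rewrite {1}/Olog ge_max; apply/andP; split; first by lra.
pose m := Num.max 1 x.
have m1 : 1 <= m by rewrite /m le_max lexx.
have xm : x <= m by rewrite /m le_max lexx orbT.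
have lm : ln m <= Olog x.
  rewrite /m; case: (leP 1 x) => _; first exact: ln_le_Olog.
  by rewrite ln1; lra.
have y0 : 0 <= 8 * a * x by rewrite !mulr_ge0//; lra.
apply: (@le_trans _ _ (ln (9 * (a * m)))).
  rewrite ler_ln ?posrE; [|lra|by rewrite !mulr_gt0//; lra].
  have : a * x <= a * m by rewrite ler_pM2l//; lra.
  have : 1 <= a * m by rewrite mulr_ege1.
  lra.
rewrite lnM ?posrE ?lnM ?posrE ?mulr_gt0//; try lra.
have := ln_le_Olog a; have := @ln_le_sub1 9 ltac:(lra); lra.
Qed.

(** Since 2 is at least [expR (1 / 2)], slightly more than [2 * ln y] doublings reach [y]. *)
Lemma pow2_ge_Olog y : exists k : nat, y <= 2 ^+ k /\ k%:R <= 3 * Olog y.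
Proof.
have o1 := Olog_ge1 y.
have [y1|y1] := leP y 1; first by exists 0%N; rewrite expr0; split=> //; lra.
have l0 : 0 <= 2 * ln y by rewrite mulr_ge0// ln_ge0// ltW.
exists (Num.truncn (2 * ln y)).+1; split; last first.
  rewrite -natr1; have : (Num.truncn (2 * ln y))%:R <= 2 * ln y.
    by rewrite truncn_le.
  by have := ln_le_Olog y; lra.
have e2 : expR (1 / 2) <= 2 :> R.
  have := expR_ge1Dx (- (1 / 2) : R); rewrite expRN => h.
  rewrite -[leRHS]invrK -[leLHS]invrK lef_pV2 ?posrE ?invr_gt0 ?expR_gt0//.
  by lra.
have y0 : 0 < y by lra.
apply: (@le_trans _ _ (expR (1 / 2) ^+ (Num.truncn (2 * ln y)).+1)).
  rewrite -expRM_natl -[leLHS]lnK ?posrE// ler_expR.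
  by have := truncnS_gt (2 * ln y); lra.
by apply: lerXn2r; rewrite ?nnegrE ?expR_ge0.
Qed.

End Olog.

(** The loops nest as states, value bisection, actions, multiplier bisection, successor states.
    Additive constants are absorbed level by level because every factor is at least 1. *)
Lemma step_count_le (S A K L : nat) : (0 < S)%N -> (0 < A)%N ->
  ((S * A * S).+1 * 30 + A.+1 * 13 + 60 +
   S.+1 * (L.+1 * (A.+2 * (K.+2 * (S.+1 * 80 + 30) + 30) + 20) + 12) <=
   1600 * (S * S * A * K.+2 * L.+1))%N.
Proof.
move=> S0 A0.
have k_le : (K.+2 <= S * K.+2)%N by rewrite leq_pmull.
have sak : (0 < S * A * K.+2)%N by rewrite !muln_gt0 S0 A0.
have sakl : (0 < S * A * K.+2 * L.+1)%N by rewrite muln_gt0 sak.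
have ssa : (S * S * A <= S * S * A * K.+2 * L.+1)%N.
  by rewrite -[X in (_ <= X)%N]mulnA leq_pmulr.
have a_le : (A <= S * S * A)%N by rewrite leq_pmull// muln_gt0 S0.
have h1 : (K.+2 * (S.+1 * 80 + 30) + 30 <= 220 * (S * K.+2))%N by lia.
have h2 : (A.+2 * (K.+2 * (S.+1 * 80 + 30) + 30) + 20 <=
    680 * (S * A * K.+2))%N.
  apply: (@leq_trans (3 * A * (220 * (S * K.+2)) + 20)); last by lia.
  by rewrite leq_add2r; apply: leq_mul => //; lia.
have h3 : (L.+1 * (A.+2 * (K.+2 * (S.+1 * 80 + 30) + 30) + 20) + 12 <=
    700 * (S * A * K.+2 * L.+1))%N.
  apply: (@leq_trans (L.+1 * (680 * (S * A * K.+2)) + 12)); last by lia.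
  by rewrite leq_add2r leq_mul.
have h4 : (S.+1 * (L.+1 * (A.+2 * (K.+2 * (S.+1 * 80 + 30) + 30) + 20) + 12) <=
    1400 * (S * S * A * K.+2 * L.+1))%N.
  apply: (@leq_trans (2 * S * (700 * (S * A * K.+2 * L.+1)))); last by lia.
  by apply: leq_mul => //; lia.
by move: h4; set T := (S.+1 * _)%N; lia.
Qed.

Theorem corollary1 (R : realType) :
  exists (c : cmd) (C : R),
  forall (S A : nat), (0 < S)%N -> (0 < A)%N ->
  forall (M : rmdp R S A) (vstar : 'rV[R]_S), is_value_limit M vstar ->
  forall v : 'rV[R]_S,
    (forall s, v 0 s <= vstar 0 s) ->
    (forall s a s', 0 <= reward M s a s' + discount M * v 0 s') ->
  forall eps : R, 0 < eps ->
  forall st : memory R, encodes M v eps st ->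
  exists (t : nat) (st' : memory R),
    [/\ exec c st t st',
        `|output S st' - bellman M v| <= eps
      & t%:R <= C * bellman_time M eps].
Proof.
(* The factor 1600 comes from [step_count_le]; 32 and 7 bound [K.+2] and [L.+1] by their
   logarithms. *)
exists robust_bellman, (1600 * (32 * 7)).
move=> S A S0 A0 M vstar lim v vle pay0 eps eps0 st enc.
have B0 := Rbar_ge0 M.
have vB j : v 0 j <= Rbar M.
  exact: le_trans (vle j) (value_limit_le A0 lim j).
have payB s a j : payoff M v s a j <= Rbar M by exact: payoff_le_Rbar.
have k0 := budget_gt0 M.
have [m0 m1] := (min_nominal_gt0 M, min_nominal_le1 M).
have lnm : 0 <= ln (min_nominal M)^-1 by rewrite lnV ?posrE// oppr_ge0 ln_le0.
set X := Rbar M ^+ 2 * ln (min_nominal M)^-1 / (eps ^+ 2 * budget M).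
have X0 : 0 <= X.
  by apply: divr_ge0; [apply: mulr_ge0 => //; exact: sqr_ge0 |
    apply/ltW/mulr_gt0 => //; exact: exprn_gt0].
have A1 : 1 <= A%:R :> R by rewrite ler1n.
(* The arguments are the ratios of initial to final interval length:
   [multiplier_max / multiplier_tol] for [K], and [Rbar M / (eps / 2)] for [L]. *)
have [K [KX Kle]] := pow2_ge_Olog (8 * A%:R * X + 1).
have [L [LB Lle]] := pow2_ge_Olog (2 * (Rbar M / eps)).
have K_large : eps / 2 < Rbar M ->
    multiplier_max M eps <= multiplier_tol M eps * 2 ^+ K.
  move=> epsB; have t0 := multiplier_tol_gt0 A0 eps0 epsB.
  apply: le_trans (_ : multiplier_tol M eps * (8 * A%:R * X + 1) <= _);
    last by rewrite ler_pM2l.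
  have B1 := Rbar_gt0 eps0 epsB.
  rewrite mulrDr mulr1 /multiplier_max lerD2r le_eqVlt; apply/orP; left.
  apply/eqP; rewrite /multiplier_tol /X lnV ?posrE//.
  move: (Rbar M) B1 => B B1.
  by field; rewrite !gt_eqF// ltr0n.
have L_large : Rbar M <= eps / 2 * 2 ^+ L.
  have -> : Rbar M = eps / 2 * (2 * (Rbar M / eps)).
    by move: (Rbar M) => B; field; rewrite gt_eqF.
  by apply: ler_wpM2l LB; rewrite ltW// divr_gt0.
have [t [st' [ex tle out]]] :=
  run_robust_bellman A0 eps0 pay0 payB K_large L_large enc.
exists t, st'; split=> //.
have [oA oX] := (Olog_ge1 (A%:R : R), Olog_ge1 X).
have oB := Olog_ge1 (Rbar M / eps).
have K2 : K.+2%:R <= 32 * (Olog (A%:R : R) * Olog X).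
  have := Olog_affine A1 X0; have : 1 <= Olog (A%:R : R) * Olog X.
    by rewrite mulr_ege1.
  by rewrite -(addn2 K) (natrD _ K 2); lra.
have L1 : L.+1%:R <= 7 * Olog (Rbar M / eps).
  have := Olog_double (divr_ge0 B0 (ltW eps0)).
  by rewrite -(addn1 L) (natrD _ L 1); lra.
have work : (S * S * A * K.+2 * L.+1)%:R <= 32 * 7 * bellman_time M eps.
  rewrite /bellman_time -/X (natrM _ _ L.+1) (natrM _ _ K.+2) !natrM.
  apply: (@le_trans _ _ (S%:R * S%:R * A%:R *
      (32 * (Olog (A%:R : R) * Olog X)) * (7 * Olog (Rbar M / eps)))).
    apply: ler_pM => //.
    by apply: ler_wpM2l K2; rewrite !mulr_ge0.
  by rewrite le_eqVlt; apply/orP; left; apply/eqP; ring.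
have scale (c : nat) : (c * (S * S * A * K.+2 * L.+1))%:R <=
    c%:R * (32 * 7) * bellman_time M eps.
  by rewrite natrM -[leRHS]mulrA ler_wpM2l.
apply: le_trans (scale _); rewrite ler_nat; apply: leq_trans tle _.
exact: step_count_le.
Qed.
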